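(* Let $a$ be a strongly regular scale factor (extended evenly to negative arguments) such that either (i) $\dot a(0^+)=0$ and there is $\epsilon>0$ with $\ddot a(t)\ge0$ on $(0,\epsilon)$, or (ii) $\infty>\dot a(0^+)>0$. Suppose also that there is a constant $C>0$ with $\left|\frac{\dddot a(t)a^2(t)}{\dot a^3(t)}\right|\le C$ for all $t>0$. Then $g_{\tau\tau}(\tau,\rho)$ is continuously differentiable on $D$.
   Context: A function $a:[0,\infty)\to[0,\infty)$ is a regular scale factor if: (a) $a(0)=0$; (b) $a$ is increasing and continuous on $[0,\infty)$, twice continuously differentiable on $(0,\infty)$, with an inverse function on $[0,\infty)$; (c) $\frac{a(t)\ddot a(t)}{\dot a(t)^2}\le1$ for all $t>0$ (presupposing $\dot a(t)\ne0$). It is strongly regular if also $\frac{a\ddot a}{\dot a^2}\ge-K$ on $(0,\infty)$ for a constant $K\ge1$. $\dot a(0^+)=\lim_{t\to0^+}\dot a(t)$. Extend $a$ by $a(-t)=a(t)$. For $\tau>0$, $\rho_{\mathcal M_\tau}=\int_0^\tau\frac{a(t)}{\sqrt{a^2(\tau)-a^2(t)}}dt$ and $D=\{(\tau,\rho):\tau>0,\ 0<\rho<2\rho_{\mathcal M_\tau}\}$. For $(\tau,\rho)\in D$, $t_0(\tau,\rho)$ is the unique $t_0\in(-\tau,\tau)$ with $\rho=\int_{t_0}^\tau\frac{a(t)}{\sqrt{a^2(\tau)-a^2(t)}}dt$. For $0\le t_0<\tau$, $f(\tau,t_0)=\int_{t_0}^{\tau}\frac{\ddot a(t)}{\dot a(t)^2}\left(\frac{\sqrt{a^2(\tau)-a^2(t_0)}}{\sqrt{a^2(\tau)-a^2(t)}}-1\right)dt$;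 for $-\tau<t_0<0$, $f(\tau,t_0)=2f(\tau,0)-f(\tau,-t_0)$. Finally $g_{\tau\tau}(\tau,\rho)=-[1-\dot a(\tau)f(\tau,t_0(\tau,\rho))]^2$ on $D$ (the extension to $D$ of the $d\tau^2$ coefficient of the Robertson–Walker metric in Fermi coordinates of the comoving observer). *)

(* Defs.v *)
From Stdlib Require Import Reals Lra ClassicalEpsilon.
From Coquelicot Require Import Coquelicot.
Open Scope R_scope.

Definition adot (a : R -> R) : R -> R := Derive a.
Definition addot (a : R -> R) : R -> R := Derive_n a 2.
Definition adddot (a : R -> R) : R -> R := Derive_n a 3.

(* Regular scale factor.  a is given on all of R, but only its values on
   [0,oo) matter; the even extension is [aext a] below. *)
Definition regular_scale_factor (a : R -> R) : Prop :=
  a 0 = 0 /\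
  (forall s t, 0 <= s -> s < t -> a s < a t) /\
  (forall t, 0 <= t -> filterlim a (within (fun x => 0 <= x) (locally t)) (locally (a t))) /\
  (forall t, 0 < t -> ex_derive a t /\ ex_derive (Derive a) t /\ continuous (addot a) t) /\
  (forall t, 0 < t -> adot a t <> 0) /\
  (forall t, 0 < t -> a t * addot a t / (adot a t) ^ 2 <= 1).

Definition strongly_regular_scale_factor (a : R -> R) (K : R) : Prop :=
  regular_scale_factor a /\ 1 <= K /\
  (forall t, 0 < t -> - K <= a t * addot a t / (adot a t) ^ 2).

Definition aext (a : R -> R) (t : R) : R := a (Rabs t).

Definition Iimp (g : R -> R) (lo hi : R) : R :=
  RInt_gen g (at_right lo) (at_left hi).

Definition rhoM (a : R -> R) (tau : R) : R :=
  Iimp (fun t => a t / sqrt (a tau ^ 2 - a t ^ 2)) 0 tau.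

Definition domD (a : R -> R) (tau rho : R) : Prop :=
  0 < tau /\ 0 < rho /\ rho < 2 * rhoM a tau.

Definition rho_of (a : R -> R) (tau t0 : R) : R :=
  Iimp (fun t => aext a t / sqrt (aext a tau ^ 2 - aext a t ^ 2)) t0 tau.

(* t0(tau, rho): the (unique) t0 in (-tau,tau) with rho = rho_of a tau t0 *)
Definition t0_of (a : R -> R) (tau rho : R) : R :=
  epsilon (inhabits 0) (fun t0 => - tau < t0 < tau /\ rho = rho_of a tau t0).

Definition f_pos (a : R -> R) (tau t0 : R) : R :=
  Iimp (fun t => addot a t / (adot a t) ^ 2 *
                 (sqrt (a tau ^ 2 - a t0 ^ 2) / sqrt (a tau ^ 2 - a t ^ 2) - 1))
       t0 tau.

Definition f_fun (a : R -> R) (tau t0 : R) : R :=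
  if Rle_dec 0 t0 then f_pos a tau t0
  else 2 * f_pos a tau 0 - f_pos a tau (- t0).

Definition g_tautau (a : R -> R) (tau rho : R) : R :=
  - (1 - adot a tau * f_fun a tau (t0_of a tau rho)) ^ 2.

(* continuously differentiable on a set D of R^2 (D open in our use):
   Frechet differentiable at every point of D, with partial derivatives
   continuous at every point of D *)
Definition C1_on (D : R -> R -> Prop) (g : R -> R -> R) : Prop :=
  exists gx gy : R -> R -> R,
    forall x y, D x y ->
      differentiable_pt_lim g x y (gx x y) (gy x y) /\
      continuity_2d_pt gx x y /\ continuity_2d_pt gy x y.

(* Main.v *)
Require Import Defs.
From Stdlib Require Import Reals Lra ClassicalEpsilon.
From Coquelicot Require Import Coquelicot.
Open Scope R_scope.

(* Put A = a(tau) and a(t) = A sin th, with a extended oddly.  With s = a(t), let H(s) be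
   the Hubble radius a / adot and l(s) = s H'(s).  Then

     rho = int_th^{PI/2} H(A sin x) dx,

   and, after one integration by parts, for t0 >= 0,

     f = (cos th / A) int_th^{PI/2} (H(A sin x) - sin x H(A)) / cos(x)^2 dx.

   The A-derivatives are the same integrals with H replaced by l / A; l is only locally
   Lipschitz (this is where the bound on the third derivative enters), which still makes
   the second integrand bounded at x = PI/2.

   At th = 0 the derivative of rho in th vanishes, so rho cannot be inverted smoothly.
   However df/dth = G drho/dth with G continuous up to th = 0, because adot has a finite
   limit at 0; as rho is monotone in th, increments of f are G times increments of rho up
   to a small relative error, and this alone gives the gradient of f as a function of
   (tau, rho). *)

(** * Real analysis *)

(** The integration by parts uses [addot / adot ^ 2 = (- / adot)']. With the primitive normalised to
    vanish at [tau], both boundary terms are zero, and only the Hubble radius remains under the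
    integral. One derivative in [tau] then costs one derivative of [H], and boundedness of the
    differentiated kernel costs a Lipschitz bound on [l].

    Writing the argument as [A sin x] has a second purpose. [H] may have infinite slope at 0, but
    [A -> H (A sin x)] is differentiable for every [x], being constant when [sin x = 0].
    Differentiation in [A] under the integral therefore never meets the singular point.

    The factor G arises as follows: the angle derivative of [f] contains a bare [sin th], and
    [sin th = adot * H / A] at the corresponding time lets [H (A sin th)] be factored out of every
    term. This is also the angle derivative of rho up to sign, and what remains involves [adot] only
    through its value at that time.

    The two alternatives of the theorem enter only through two consequences: [adot] has a finite
    limit at 0, and [a / adot] tends to 0 there. *)

Lemma is_derive_continuity_pt (f : R -> R) (t l : R) :
  is_derive f t l -> continuity_pt f t.
Proof.
intros H; apply continuity_pt_filterlim.
apply (ex_derive_continuous f); now exists l.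
Qed.

(** Serves at angle 0 and at time 0, where a derivative formula is known on both sides of the point
    but not at it. By the mean value theorem each difference quotient is a nearby value of [df], and
    these tend to [df c]. *)
Lemma is_derive_extend (f df : R -> R) (c d : R) :
  0 < d -> continuity_pt f c ->
  (forall t, Rabs (t - c) < d -> t <> c -> is_derive f t (df t)) ->
  continuity_pt df c -> is_derive f c (df c).
Proof.
intros Hd Hf Hdf Hc; apply is_derive_Reals; intros eps Heps.
destruct (Hc eps Heps) as [al [Hal H]].
assert (Hm : 0 < Rmin al d) by (apply Rmin_pos; lra).
exists (mkposreal _ Hm); simpl; intros h Hh0 Hh.
assert (Hh1 : Rabs h < al) by (apply Rlt_le_trans with (1 := Hh); apply Rmin_l).
assert (Hh2 : Rabs h < d) by (apply Rlt_le_trans with (1 := Hh); apply Rmin_r).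
assert (B : forall x, Rmin c (c + h) <= x <= Rmax c (c + h) -> Rabs (x - c) <= Rabs h).
{ intros x; unfold Rmin, Rmax; destruct (Rle_dec c (c + h)); intros;
  unfold Rabs; repeat destruct Rcase_abs; lra. }
destruct (MVT_gen f c (c + h) df) as [x [Hx E]].
- intros x Hx; apply Hdf.
  + apply Rle_lt_trans with (2 := Hh2); apply B; lra.
  + revert Hx; unfold Rmin, Rmax; destruct (Rle_dec c (c + h)); lra.
- intros x Hx; destruct (Req_dec x c) as [->|N]; [exact Hf|].
  apply is_derive_continuity_pt with (df x); apply Hdf; auto.
  apply Rle_lt_trans with (2 := Hh2); auto.
- rewrite E; replace (df x * (c + h - c) / h - df c) with (df x - df c) by (field; auto).
  destruct (Req_dec x c) as [->|N]; [rewrite Rminus_diag, Rabs_R0; auto|].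
  apply (H x); split; [split; [exact I|auto]|].
  simpl; unfold Rdist; apply Rle_lt_trans with (2 := Hh1); auto.
Qed.

Lemma derive_nonneg_le (f df : R -> R) (u v : R) :
  u <= v -> (forall t, u < t < v -> is_derive f t (df t)) ->
  (forall t, u <= t <= v -> continuity_pt f t) ->
  (forall t, u <= t <= v -> 0 <= df t) -> f u <= f v.
Proof.
intros Huv Hd Hc Hp; destruct (MVT_gen f u v df) as [c [Hc' E]].
- rewrite Rmin_left, Rmax_right; auto.
- rewrite Rmin_left, Rmax_right; auto.
- rewrite Rmin_left, Rmax_right in Hc' by auto.
  assert (0 <= df c * (v - u)) by (apply Rmult_le_pos; [auto|lra]); lra.
Qed.

Lemma abs_RInt_le (f : R -> R) (a b M : R) :
  ex_RInt f a b -> (forall t, Rmin a b <= t <= Rmax a b -> Rabs (f t) <= M) ->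
  Rabs (RInt f a b) <= Rabs (b - a) * M.
Proof.
intros He HM; destruct (Rle_dec a b) as [H|H].
- rewrite (Rabs_pos_eq (b - a)) by lra; apply abs_RInt_le_const; auto.
  rewrite Rmin_left, Rmax_right in HM; auto.
- rewrite Rabs_minus_sym, (Rabs_pos_eq (a - b)) by lra.
  rewrite <- opp_RInt_swap by (apply ex_RInt_swap; auto).
  change (Rabs (- RInt f b a) <= (a - b) * M); rewrite Rabs_Ropp.
  apply abs_RInt_le_const; [lra|apply ex_RInt_swap; auto|].
  rewrite Rmin_right, Rmax_left in HM by lra; auto.
Qed.

Lemma continuity_2d_pt_comp2 (h f g : R -> R -> R) (x y : R) :
  continuity_2d_pt h (f x y) (g x y) ->
  continuity_2d_pt f x y -> continuity_2d_pt g x y ->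
  continuity_2d_pt (fun u v => h (f u v) (g u v)) x y.
Proof.
intros Hh Hf Hg eps; destruct (Hh eps) as [d H].
apply locally_2d_impl with (2 := locally_2d_and _ _ _ _ (Hf d) (Hg d)).
apply locally_2d_forall; intros u v [H1 H2]; auto.
Qed.

Lemma continuity_2d_pt_section (f : R -> R -> R) (x y : R) :
  continuity_2d_pt f x y -> continuity_pt (f x) y.
Proof.
intros H; apply continuity_pt_filterlim; intros Q [e He].
destruct (H e) as [d Hd]; exists d; intros v Hv; apply He, Hd; auto.
rewrite Rminus_diag, Rabs_R0; apply cond_pos.
Qed.

Lemma continuity_2d_pt_snd (f : R -> R) (x y : R) :
  continuity_pt f y -> continuity_2d_pt (fun _ v => f v) x y.
Proof.
intros H; apply continuity_1d_2d_pt_comp with (g := fun _ v => v); auto.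
apply continuity_2d_pt_id2.
Qed.

Lemma continuity_2d_pt_fst (f : R -> R) (x y : R) :
  continuity_pt f x -> continuity_2d_pt (fun u _ => f u) x y.
Proof.
intros H; apply continuity_1d_2d_pt_comp with (g := fun u _ => u); auto.
apply continuity_2d_pt_id1.
Qed.

Lemma continuity_pt_continuous (f : R -> R) (x : R) :
  continuity_pt f x -> continuous f x.
Proof. intros H; now apply continuity_pt_filterlim. Qed.

(** The increment splits in two: the integral of [w A - w A0] over the fixed segment, small by
    uniform continuity near a compact set, and the integral of [w A] over the short segment from
    [X0] to [X], small because [w] is bounded near [(A0, X0)]. *)
Lemma continuity_2d_pt_RInt (w : R -> R -> R) (c A0 X0 d : R) :
  0 < d ->
  (forall A x, Rabs (A - A0) < d -> Rmin c X0 - d < x < Rmax c X0 + d ->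
     continuity_2d_pt w A x) ->
  continuity_2d_pt (fun A X => RInt (w A) c X) A0 X0.
Proof.
intros Hd Hw eps.
set (m := Rmin c X0) in *; set (M := Rmax c X0) in *.
assert (HmM : m <= M).
{ apply Rle_trans with c; [apply Rmin_l|apply Rmax_l]. }
assert (HX0 : m <= X0 <= M) by (split; [apply Rmin_r|apply Rmax_r]).
(* [M - m] is 0 when [X0 = c]; the added 1 keeps the quotient meaningful. *)
assert (He1 : 0 < eps / 2 / (M - m + 1)).
{ apply Rdiv_lt_0_compat; [|lra]; generalize (cond_pos eps); lra. }
destruct (uniform_continuity_2d_1d' w m M A0) with (eps := mkposreal _ He1)
  as [d1 H1].
{ intros x Hx; apply Hw; [rewrite Rminus_diag, Rabs_R0|]; lra. }
destruct (Hw A0 X0) with (eps := mkposreal 1 Rlt_0_1) as [d2 H2].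
{ rewrite Rminus_diag, Rabs_R0; lra. } { lra. }
set (N := Rabs (w A0 X0) + 1).
assert (HN : 0 < N) by (unfold N; generalize (Rabs_pos (w A0 X0)); lra).
assert (He2 : 0 < eps / 2 / N).
{ apply Rdiv_lt_0_compat; [|lra]; generalize (cond_pos eps); lra. }
assert (Hdl : 0 < Rmin (Rmin d1 d2) (Rmin d (eps / 2 / N))).
{ repeat apply Rmin_pos; auto; apply cond_pos. }
exists (mkposreal _ Hdl); simpl; intros A X HA HX.
assert (L1 := Rmin_l (Rmin d1 d2) (Rmin d (eps / 2 / N))).
assert (L2 := Rmin_r (Rmin d1 d2) (Rmin d (eps / 2 / N))).
assert (L3 := Rmin_l d1 d2); assert (L4 := Rmin_r d1 d2).
assert (L5 := Rmin_l d (eps / 2 / N)); assert (L6 := Rmin_r d (eps / 2 / N)).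
assert (cA : forall B x, Rabs (B - A0) < d -> m - d < x < M + d -> continuous (w B) x).
{ intros B x HB Hx; apply continuity_pt_continuous, continuity_2d_pt_section; auto. }
assert (E1 : ex_RInt (w A) c X0).
{ apply (ex_RInt_continuous (w A)); intros z Hz; fold m M in Hz; apply cA; lra. }
assert (E2 : ex_RInt (w A0) c X0).
{ apply (ex_RInt_continuous (w A0)); intros z Hz; fold m M in Hz; apply cA; [|lra].
  rewrite Rminus_diag, Rabs_R0; lra. }
assert (BX : forall z, Rmin X0 X <= z <= Rmax X0 X -> Rabs (z - X0) <= Rabs (X - X0)).
{ intros z; unfold Rmin, Rmax; destruct (Rle_dec X0 X); intros;
  unfold Rabs; repeat destruct Rcase_abs; lra. }
assert (E3 : ex_RInt (w A) X0 X).
{ apply (ex_RInt_continuous (w A)); intros z Hz; apply cA; [lra|].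
  assert (Hb := BX z Hz); revert Hb HX; unfold Rabs; repeat destruct Rcase_abs; lra. }
rewrite <- (RInt_Chasles (w A) c X0 X E1 E3).
unfold plus; simpl.
replace (RInt (w A) c X0 + RInt (w A) X0 X - RInt (w A0) c X0)
  with (RInt (fun x => w A x - w A0 x) c X0 + RInt (w A) X0 X).
2:{ rewrite (RInt_minus (w A) (w A0)) by auto; unfold minus, plus, opp; simpl; ring. }
apply Rle_lt_trans with (1 := Rabs_triang _ _).
assert (B1 : Rabs (RInt (fun x => w A x - w A0 x) c X0)
             <= Rabs (X0 - c) * (eps / 2 / (M - m + 1))).
{ apply abs_RInt_le; [apply (ex_RInt_minus (w A) (w A0)); auto|].
  intros t Ht; fold m M in Ht.
  apply Rlt_le, (H1 t A0 t A); try lra.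
  - revert HA; unfold Rabs; destruct Rcase_abs; lra.
  - rewrite Rminus_diag, Rabs_R0; apply cond_pos. }
assert (B2 : Rabs (RInt (w A) X0 X) <= Rabs (X - X0) * N).
{ apply abs_RInt_le; auto; intros t Ht.
  assert (Hb := BX t Ht).
  assert (Hb2 : Rabs (w A t - w A0 X0) < 1) by (apply H2; lra).
  unfold N; assert (T := Rabs_triang_inv (w A t) (w A0 X0)); lra. }
assert (B3 : Rabs (X0 - c) <= M - m).
{ unfold M, m, Rmin, Rmax; destruct (Rle_dec c X0); unfold Rabs; destruct Rcase_abs; lra. }
assert (B4 : Rabs (X0 - c) * (eps / 2 / (M - m + 1)) <= eps / 2).
{ apply Rle_trans with ((M - m + 1) * (eps / 2 / (M - m + 1))).
  - apply Rmult_le_compat_r; lra.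
  - right; field; lra. }
assert (B5 : Rabs (X - X0) * N < eps / 2).
{ apply Rlt_le_trans with (eps / 2 / N * N); [apply Rmult_lt_compat_r; lra|].
  right; field; lra. }
lra.
Qed.

(** Both ends are improper, so only one-sided limits of the primitive are required; convergence of
    the integral comes together with its value. *)
Lemma Iimp_FTC (g F : R -> R) (lo hi la lb : R) :
  lo < hi ->
  (forall t, lo < t < hi -> is_derive F t (g t)) ->
  (forall t, lo < t < hi -> continuity_pt g t) ->
  filterlim F (at_right lo) (locally la) ->
  filterlim F (at_left hi) (locally lb) -> Iimp g lo hi = lb - la.
Proof.
intros Hlh HF Hg Hla Hlb; unfold Iimp; apply is_RInt_gen_unique.
set (mid := (lo + hi) / 2).
assert (Hp : filter_prod (at_right lo) (at_left hi)
   (fun ab : R * R => forall x, Rmin (fst ab) (snd ab) <= x <= Rmax (fst ab) (snd ab) ->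
      lo < x < hi)).
(* Separating the two moving ends by [mid] keeps the segment between them inside the open
   interval. *)
{ apply Filter_prod with (fun u => lo < u < mid) (fun u => mid < u < hi).
  - assert (Hh : 0 < mid - lo) by (unfold mid; lra).
    exists (mkposreal _ Hh); simpl; intros u Hu Hu2.
    unfold ball in Hu; simpl in Hu; unfold AbsRing_ball, abs, minus, plus, opp in Hu; simpl in Hu.
    revert Hu; unfold Rabs; destruct Rcase_abs; lra.
  - assert (Hh : 0 < hi - mid) by (unfold mid; lra).
    exists (mkposreal _ Hh); simpl; intros u Hu Hu2.
    unfold ball in Hu; simpl in Hu; unfold AbsRing_ball, abs, minus, plus, opp in Hu; simpl in Hu.
    revert Hu; unfold Rabs; destruct Rcase_abs; lra.
  - simpl; intros x y Hx Hy z; rewrite Rmin_left, Rmax_right; lra. }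
assert (HD : forall t, lo < t < hi -> Derive F t = g t).
{ intros t Ht; apply is_derive_unique; auto. }
apply (is_RInt_gen_ext (Derive F)).
- revert Hp; apply filter_imp; intros ab Hab x Hx; apply HD, Hab; lra.
- apply is_RInt_gen_Derive; auto.
  + revert Hp; apply filter_imp; intros ab Hab x Hx; exists (g x); apply HF; auto.
  + revert Hp; apply filter_imp; intros ab Hab x Hx; apply Hab in Hx.
    apply continuous_ext_loc with g; [|apply continuity_pt_continuous; auto].
    assert (Hh : 0 < Rmin (x - lo) (hi - x)) by (apply Rmin_pos; lra).
    exists (mkposreal _ Hh); simpl; intros u Hu.
    unfold ball in Hu; simpl in Hu; unfold AbsRing_ball, abs, minus, plus, opp in Hu; simpl in Hu.
    symmetry; apply HD.
    assert (L1 := Rmin_l (x - lo) (hi - x)); assert (L2 := Rmin_r (x - lo) (hi - x)).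
    revert Hu; unfold Rabs; destruct Rcase_abs; lra.
Qed.

Lemma is_derive_eps (f : R -> R) (x l eps : R) :
  is_derive f x l -> 0 < eps ->
  exists d, 0 < d /\ forall u, Rabs (u - x) < d ->
    Rabs (f u - f x - l * (u - x)) <= eps * Rabs (u - x).
Proof.
intros H Heps; apply is_derive_Reals in H.
destruct (H eps Heps) as [d Hd]; exists d; split; [apply cond_pos|].
intros u Hu; destruct (Req_dec u x) as [->|N].
- rewrite !Rminus_diag, Rmult_0_r, Rminus_diag, Rabs_R0; lra.
- assert (Hn : u - x <> 0) by lra.
  specialize (Hd (u - x) Hn Hu); replace (x + (u - x)) with u in Hd by ring.
  replace (f u - f x - l * (u - x)) with (((f u - f x) / (u - x) - l) * (u - x))
    by (field; auto).
  rewrite Rabs_mult; apply Rmult_le_compat_r; [apply Rabs_pos|lra].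
Qed.

(* No invertibility of the partial derivative of [S] in its second argument is
   required: increments of [P] are compared with increments of [S], and the
   latter are prescribed by [S u (T u v) = v]. *)
Lemma differentiable_along_level (P S T : R -> R -> R) (x y g SA PA : R) :
  locally_2d (fun u v => S u (T u v) = v) x y ->
  (forall eps, 0 < eps -> exists d, 0 < d /\ forall u t, Rabs (u - x) < d ->
     Rabs (t - T x y) < d ->
     Rabs (P u t - P u (T x y) - g * (S u t - S u (T x y)))
       <= eps * Rabs (S u t - S u (T x y))) ->
  is_derive (fun u => S u (T x y)) x SA ->
  is_derive (fun u => P u (T x y)) x PA ->
  continuity_2d_pt T x y ->
  differentiable_pt_lim (fun u v => P u (T u v)) x y (PA - g * SA) g.
Proof.
intros HL HP HS HPA HT eps.
set (t0 := T x y) in *.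
(* The three remainders cost [Rabs SA + 2], 1 and [Rabs g] times [e], so [k] exceeds what is needed
   by 1. The bound [e <= 1] chosen below lets the error in [S] be absorbed into [Rabs SA + 2]. *)
set (k := Rabs SA + Rabs g + 4).
assert (Hk : 0 < k) by (unfold k; generalize (Rabs_pos SA) (Rabs_pos g); lra).
set (e := Rmin 1 (eps / k)).
assert (He : 0 < e).
{ apply Rmin_pos; [lra|]; apply Rdiv_lt_0_compat; [apply cond_pos|auto]. }
assert (He1 : e <= 1) by apply Rmin_l.
assert (He2 : e * k <= eps).
{ apply Rle_trans with (eps / k * k); [apply Rmult_le_compat_r; [lra|apply Rmin_r]|].
  right; field; lra. }
destruct (HP e He) as [d1 [Hd1 H1]].
destruct (is_derive_eps _ _ _ e HS He) as [d2 [Hd2 H2]].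
destruct (is_derive_eps _ _ _ e HPA He) as [d3 [Hd3 H3]].
assert (Hd : 0 < Rmin d1 (Rmin d2 d3)) by (repeat apply Rmin_pos; auto).
assert (L1 := Rmin_l d1 (Rmin d2 d3)); assert (L2 := Rmin_r d1 (Rmin d2 d3)).
assert (L3 := Rmin_l d2 d3); assert (L4 := Rmin_r d2 d3).
assert (HT1 := HT (mkposreal _ Hd1)); simpl in HT1.
assert (HL0 := locally_2d_singleton _ _ _ HL); simpl in HL0; fold t0 in HL0.
destruct HL as [d4 HL]; destruct HT1 as [d5 HT1].
assert (Hdd : 0 < Rmin (Rmin d1 (Rmin d2 d3)) (Rmin d4 d5)).
{ repeat apply Rmin_pos; auto; apply cond_pos. }
exists (mkposreal _ Hdd); simpl; intros u v Hu Hv.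
assert (L5 := Rmin_l (Rmin d1 (Rmin d2 d3)) (Rmin d4 d5)).
assert (L6 := Rmin_r (Rmin d1 (Rmin d2 d3)) (Rmin d4 d5)).
assert (L7 := Rmin_l d4 d5); assert (L8 := Rmin_r d4 d5).
specialize (HT1 u v ltac:(lra) ltac:(lra)); fold t0 in HT1.
specialize (HL u v ltac:(lra) ltac:(lra)).
specialize (H1 u (T u v) ltac:(lra) HT1).
specialize (H2 u ltac:(lra)); specialize (H3 u ltac:(lra)); simpl in H2, H3.
rewrite HL in H1; rewrite HL0 in H2.
set (m := Rmax (Rabs (u - x)) (Rabs (v - y))).
assert (M1 : Rabs (u - x) <= m) by apply Rmax_l.
assert (M2 : Rabs (v - y) <= m) by apply Rmax_r.
assert (Hm : 0 <= m) by (generalize (Rabs_pos (u - x)); lra).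
set (r2 := S u t0 - y - SA * (u - x)) in H2.
set (r3 := P u t0 - P x t0 - PA * (u - x)) in H3.
set (r1 := P u (T u v) - P u t0 - g * (v - S u t0)) in H1.
replace (P u (T u v) - P x t0 - ((PA - g * SA) * (u - x) + g * (v - y)))
  with (r1 + r3 + - g * r2) by (unfold r1, r2, r3; ring).
assert (B0 : e * Rabs (u - x) <= e * m) by (apply Rmult_le_compat_l; lra).
assert (B0' : e * m <= 1 * m) by (apply Rmult_le_compat_r; lra).
assert (B1 : Rabs (v - S u t0) <= (Rabs SA + 2) * m).
{ replace (v - S u t0) with ((v - y) + (- SA * (u - x)) + - r2) by (unfold r2; ring).
  assert (T1 := Rabs_triang (v - y + - SA * (u - x)) (- r2)).
  assert (T2 := Rabs_triang (v - y) (- SA * (u - x))).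
  rewrite Rabs_Ropp in T1; rewrite Rabs_mult, Rabs_Ropp in T2.
  assert (Rabs SA * Rabs (u - x) <= Rabs SA * m)
    by (apply Rmult_le_compat_l; auto; apply Rabs_pos).
  lra. }
assert (B2 : e * Rabs (v - S u t0) <= e * ((Rabs SA + 2) * m))
  by (apply Rmult_le_compat_l; lra).
assert (B3 : Rabs (- g * r2) <= Rabs g * (e * m)).
{ rewrite Rabs_mult, Rabs_Ropp; apply Rmult_le_compat_l; [apply Rabs_pos|lra]. }
assert (T1 := Rabs_triang (r1 + r3) (- g * r2)).
assert (T2 := Rabs_triang r1 r3).
assert (B4 : e * k * m <= eps * m) by (apply Rmult_le_compat_r; auto).
assert (B5 : 0 <= e * m) by (apply Rmult_le_pos; lra).
replace (e * k * m) with (e * ((Rabs SA + 2) * m) + e * m + Rabs g * (e * m) + e * m) in B4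
  by (unfold k; ring).
lra.
Qed.

(** * The integrals attached to a Hubble profile *)

Definition lipschitz_near (phi : R -> R) (A : R) : Prop :=
  exists d M, 0 < d /\ 0 <= M /\ forall s t, Rabs (s - A) < d -> Rabs (t - A) < d ->
    Rabs (phi s - phi t) <= M * Rabs (s - t).

(* With [s] the value of the scale factor: [H] is the Hubble radius [a / adot],
   [l] is [s * H'], and [p] is [adot], all extended evenly to [s < 0]. *)
Record hubble_profile (H l p : R -> R) : Prop := {
  hp_cont_H : forall s, continuity_pt H s;
  hp_cont_l : forall s, continuity_pt l s;
  hp_cont_p : forall s, continuity_pt p s;
  hp_even_H : forall s, H (- s) = H s;
  hp_even_l : forall s, l (- s) = l s;
  hp_even_p : forall s, p (- s) = p s;
  hp_H0 : H 0 = 0;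
  hp_l0 : l 0 = 0;
  hp_H_pos : forall s, 0 < s -> 0 < H s;
  hp_p_H : forall s, 0 < s -> p s * H s = s;
  hp_derive : forall s, 0 < s -> is_derive H s (l s / s);
  hp_lip_H : forall s, 0 < s -> lipschitz_near H s;
  hp_lip_l : forall s, 0 < s -> lipschitz_near l s }.

(* [(phi (A sin th) - sin th * phi A) / cos th ^ 2] against [d th], in the variable
   [th = PI / 2 - x ^ 2]: the Jacobian [2 x] restores continuity at [th = PI / 2],
   where the quotient is merely bounded. *)
Definition kern (phi : R -> R) (A x : R) : R :=
  2 * x * (phi (A * cos (x ^ 2)) - cos (x ^ 2) * phi A) / sin (x ^ 2) ^ 2.

(** The substitution sends [Rabs th] to [sqrt (PI / 2 - Rabs th)] and [PI / 2] to 0. The absolute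
    value makes the integral even in the angle, as the reflection of [f] to negative [t0]
    requires. *)
Definition kern_int (phi : R -> R) (A th : R) : R :=
  RInt (kern phi A) 0 (sqrt (PI / 2 - Rabs th)).

Definition dist_int (H : R -> R) (A th : R) : R :=
  RInt (fun x => H (A * sin x)) th (PI / 2).

(** The arguments are the positive and negative parts of [th]. For even [q] this is the rule that
    extends [f] to negative [t0], in a form without case distinction, so that continuity and
    derivatives in a parameter pass through it directly. *)
Definition odd_reflection (q : R -> R) (th : R) : R :=
  q ((th + Rabs th) / 2) + q 0 - q ((th - Rabs th) / 2).

Definition half_shift (H : R -> R) (A th : R) : R := cos th * kern_int H A th / A.

Definition half_shift_A (H l : R -> R) (A th : R) : R :=
  cos th * (kern_int l A th - kern_int H A th) / A ^ 2.

(** The factor G of the overview. It comes from the angle derivative of [half_shift] by replacing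
    [sin th] with [p s * H s / A] at [s = A * sin th] and dividing by [- H s]. Since [p] is
    continuous at 0, nothing is singular at [th = 0]. *)
Definition shift_slope (H p : R -> R) (A th : R) : R :=
  (p (A * sin th) / A * (kern_int H A th - H A / cos th) + / cos th) / A.

(** * Joint continuity of the kernel and derivatives of its integral *)

Lemma continuity_pt_pow2 (x : R) : continuity_pt (fun x => x ^ 2) x.
Proof. apply is_derive_continuity_pt with (2 * x); auto_derive; auto; ring. Qed.

Lemma PI_half_gt_1 : 1 < PI / 2.
Proof. generalize PI2_1; lra. Qed.

(** For [x <> 0] the denominator is positive and everything is a composition. At [x = 0] put
    [c = cos (x ^ 2)]: the numerator [(phi (A * c) - phi A) + (1 - c) * phi A] is of order [1 - c]
    by the Lipschitz bound, the denominator is [(1 - c) * (1 + c)], so the quotient is bounded and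
    the factor [2 * x] makes the kernel vanish. *)
Lemma continuity_2d_pt_kern (phi : R -> R) (A x : R) :
  (forall s, continuity_pt phi s) -> lipschitz_near phi A -> 0 < A -> x ^ 2 < PI ->
  continuity_2d_pt (kern phi) A x.
Proof.
intros Hc Hl HA Hx.
assert (C2 : forall u v, continuity_2d_pt (fun _ v => cos (v ^ 2)) u v).
{ intros; apply (continuity_1d_2d_pt_comp cos (fun _ v => v ^ 2)); [apply continuity_cos|].
  apply (continuity_2d_pt_snd (fun v => v ^ 2)), continuity_pt_pow2. }
assert (C3 : forall u v, continuity_2d_pt (fun u v => u * cos (v ^ 2)) u v).
{ intros; apply (continuity_2d_pt_mult (fun u _ => u) (fun _ v => cos (v ^ 2))); auto.
  apply continuity_2d_pt_id1. }
destruct (Req_dec x 0) as [->|N].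
- intros eps; destruct Hl as [d [M [Hd [HM Hl]]]].
  destruct (C3 A 0 (mkposreal _ Hd)) as [d1 H1]; simpl in H1.
  (* [N / 2] will bound the quotient: the first term is the Lipschitz part with [u < A + d], the
     second bounds [phi u], and the 1 only ensures positivity. Together with the factor [2 * v] this
     gives [Rabs v * N]. *)
  set (N := 2 * (M * (A + d) + (Rabs (phi A) + M * d)) + 1).
  assert (HN : 0 < N).
  { unfold N; assert (0 <= M * (A + d)) by (apply Rmult_le_pos; lra).
    assert (0 <= M * d) by (apply Rmult_le_pos; lra).
    generalize (Rabs_pos (phi A)); lra. }
  assert (He : 0 < eps / N) by (apply Rdiv_lt_0_compat; [apply cond_pos|auto]).
  (* [d] and [d1] keep [u] and [u * cos (v ^ 2)] in the Lipschitz range, [1] keeps [v ^ 2] below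
     [PI / 2], [A] keeps [u] positive, and [eps / N] gives the final estimate. *)
  assert (Hm : 0 < Rmin (Rmin d d1) (Rmin (Rmin 1 A) (eps / N))).
  { repeat apply Rmin_pos; auto; try apply cond_pos; lra. }
  exists (mkposreal _ Hm); simpl; intros u v Hu Hv.
  assert (L1 := Rmin_l (Rmin d d1) (Rmin (Rmin 1 A) (eps / N))).
  assert (L2 := Rmin_r (Rmin d d1) (Rmin (Rmin 1 A) (eps / N))).
  assert (L3 := Rmin_l d d1); assert (L4 := Rmin_r d d1).
  assert (L5 := Rmin_l (Rmin 1 A) (eps / N)); assert (L6 := Rmin_r (Rmin 1 A) (eps / N)).
  assert (L7 := Rmin_l 1 A); assert (L8 := Rmin_r 1 A).
  specialize (H1 u v ltac:(lra) ltac:(lra)).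
  replace (kern phi A 0) with 0 by (unfold kern, Rdiv; ring).
  rewrite Rminus_0_r; rewrite Rminus_0_r in Hv.
  replace (A * cos (0 * (0 * 1))) with A in H1 by (rewrite Rmult_0_l, cos_0; ring).
  change (v * (v * 1)) with (v ^ 2) in H1.
  destruct (Req_dec v 0) as [->|Nv].
  { unfold kern, Rdiv; rewrite Rmult_0_r, !Rmult_0_l, Rabs_R0; apply cond_pos. }
  assert (V1 : 0 < v ^ 2) by (apply pow2_gt_0; auto).
  assert (V2 : v ^ 2 < 1).
  { rewrite <- pow2_abs; assert (0 <= Rabs v) by apply Rabs_pos; nra. }
  assert (HP := PI_half_gt_1).
  set (c := cos (v ^ 2)) in *.
  assert (c0 : 0 < c) by (apply cos_gt_0; lra).
  assert (c1 : c < 1).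
  { unfold c; rewrite <- cos_0; apply cos_decreasing_1; lra. }
  assert (S : sin (v ^ 2) ^ 2 = (1 - c) * (1 + c)).
  { assert (T := sin2_cos2 (v ^ 2)); unfold Rsqr in T; unfold c; nra. }
  unfold kern; rewrite S; fold c.
  assert (Hu0 : 0 < u) by (revert Hu; unfold Rabs; destruct Rcase_abs; lra).
  assert (Hu1 : u < A + d) by (revert Hu; unfold Rabs; destruct Rcase_abs; lra).
  assert (B1 : Rabs (phi (u * c) - phi u) <= M * ((1 - c) * (A + d))).
  { apply Rle_trans with (M * Rabs (u * c - u)); [apply Hl; lra|].
    apply Rmult_le_compat_l; auto.
    replace (u * c - u) with (- ((1 - c) * u)) by ring.
    rewrite Rabs_Ropp, Rabs_pos_eq by (apply Rmult_le_pos; lra).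
    apply Rmult_le_compat_l; lra. }
  assert (B2 : Rabs (phi u) <= Rabs (phi A) + M * d).
  { assert (T : Rabs (phi u - phi A) <= M * Rabs (u - A)).
    { apply Hl; [lra|rewrite Rminus_diag, Rabs_R0; lra]. }
    assert (M * Rabs (u - A) <= M * d) by (apply Rmult_le_compat_l; lra).
    assert (T2 := Rabs_triang_inv (phi u) (phi A)); lra. }
  assert (B3 : Rabs (phi (u * c) - c * phi u) <= (1 - c) * (N / 2)).
  { replace (phi (u * c) - c * phi u) with ((phi (u * c) - phi u) + (1 - c) * phi u) by ring.
    apply Rle_trans with (1 := Rabs_triang _ _).
    rewrite (Rabs_mult (1 - c)), (Rabs_pos_eq (1 - c)) by lra.
    assert ((1 - c) * Rabs (phi u) <= (1 - c) * (Rabs (phi A) + M * d))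
      by (apply Rmult_le_compat_l; lra).
    unfold N; lra. }
  replace (2 * v * (phi (u * c) - c * phi u) / ((1 - c) * (1 + c)))
    with (2 * v * ((phi (u * c) - c * phi u) / ((1 - c) * (1 + c)))) by (field; lra).
  rewrite Rabs_mult, (Rabs_mult 2 v), (Rabs_pos_eq 2) by lra.
  assert (B4 : Rabs ((phi (u * c) - c * phi u) / ((1 - c) * (1 + c))) <= N / 2).
  { rewrite Rabs_div by (apply Rgt_not_eq, Rmult_lt_0_compat; lra).
    rewrite (Rabs_pos_eq ((1 - c) * (1 + c))) by (apply Rmult_le_pos; lra).
    apply Rle_div_l; [apply Rmult_lt_0_compat; lra|].
    apply Rle_trans with (1 := B3).
    replace (N / 2 * ((1 - c) * (1 + c))) with ((1 - c) * (N / 2) + (1 - c) * (N / 2) * c) by ring.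
    assert (0 <= (1 - c) * (N / 2) * c) by (repeat apply Rmult_le_pos; lra); lra. }
  apply Rle_lt_trans with (2 * Rabs v * (N / 2)).
  { apply Rmult_le_compat_l; auto; generalize (Rabs_pos v); lra. }
  apply Rlt_le_trans with (eps / N * N); [|right; field; lra].
  replace (2 * Rabs v * (N / 2)) with (Rabs v * N) by field.
  apply Rmult_lt_compat_r; lra.
- unfold kern, Rdiv.
  apply continuity_2d_pt_mult with (g := fun _ x => / sin (x ^ 2) ^ 2)
     (f := fun A x => 2 * x * (phi (A * cos (x ^ 2)) - cos (x ^ 2) * phi A)).
  + apply continuity_2d_pt_mult with (f := fun _ x => 2 * x)
     (g := fun A x => (phi (A * cos (x ^ 2)) - cos (x ^ 2) * phi A)).
    * apply (continuity_2d_pt_snd (fun x => 2 * x)).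
      apply is_derive_continuity_pt with 2; auto_derive; auto; ring.
    * apply (continuity_2d_pt_minus (fun A x => phi (A * cos (x ^ 2)))
         (fun A x => cos (x ^ 2) * phi A)).
      -- apply (continuity_1d_2d_pt_comp phi (fun A x => A * cos (x ^ 2))); auto.
      -- apply (continuity_2d_pt_mult (fun A x => cos (x ^ 2)) (fun A x => phi A)); auto.
         apply continuity_2d_pt_fst; auto.
  + assert (S : 0 < sin (x ^ 2)) by (apply sin_gt_0; auto; apply pow2_gt_0; auto).
    apply continuity_2d_pt_inv with (f := fun _ x => sin (x ^ 2) ^ 2).
    * apply (continuity_2d_pt_snd (fun x => sin (x ^ 2) ^ 2)).
      eapply is_derive_continuity_pt; auto_derive; auto; reflexivity.
    * apply Rgt_not_eq, pow_lt; auto.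
Qed.

(** For [c > 0] the chain rule gives [c * H' (u * c)], which is [l (u * c) / u]. Negative [c]
    follows by evenness, and for [c = 0] both sides vanish identically, so differentiability of [H]
    at 0 never comes up. *)
Lemma is_derive_profile_scale (H l p : R -> R) (c u : R) :
  hubble_profile H l p -> 0 < u -> is_derive (fun u => H (u * c)) u (l (u * c) / u).
Proof.
intros HP.
assert (P : forall c u, 0 < c -> 0 < u -> is_derive (fun u => H (u * c)) u (l (u * c) / u)).
{ clear c u; intros c u Hc Hu.
  replace (l (u * c) / u) with (scal c (l (u * c) / (u * c)))
    by (unfold scal; simpl; unfold mult; simpl; field; lra).
  apply (is_derive_comp H (fun u => u * c)).
  - apply (hp_derive _ _ _ HP), Rmult_lt_0_compat; auto.
  - auto_derive; auto; ring. }
intros Hu; destruct (Rtotal_order c 0) as [Hc|[->|Hc]]; [| |apply P; auto].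
- rewrite <- (hp_even_l _ _ _ HP).
  replace (- (u * c)) with (u * - c) by ring.
  apply is_derive_ext with (fun u => H (u * - c)); [|apply P; lra].
  intros t; rewrite <- (hp_even_H _ _ _ HP); f_equal; ring.
- rewrite Rmult_0_r, (hp_l0 _ _ _ HP).
  apply is_derive_ext with (fun _ => 0).
  + intros t; now rewrite Rmult_0_r, (hp_H0 _ _ _ HP).
  + unfold Rdiv; rewrite Rmult_0_l; apply (is_derive_const (K := R_AbsRing) (V := R_NormedModule) 0).
Qed.

Lemma locally_pos (A : R) : 0 < A -> locally A (fun u => 0 < u).
Proof. intros HA; apply (open_gt 0); auto. Qed.

Lemma sqrt_sq_lt_PI (th x : R) : Rabs th < PI / 2 -> 0 <= x <= sqrt (PI / 2 - Rabs th) ->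
  x ^ 2 <= PI / 2.
Proof.
intros Hth [H1 H2].
assert (S : sqrt (PI / 2 - Rabs th) ^ 2 = PI / 2 - Rabs th) by (apply pow2_sqrt; lra).
assert (x ^ 2 <= sqrt (PI / 2 - Rabs th) ^ 2) by (apply pow_incr; auto).
generalize (Rabs_pos th); lra.
Qed.

Lemma kern_continuous (phi : R -> R) (A x : R) :
  (forall s, continuity_pt phi s) -> (forall s, 0 < s -> lipschitz_near phi s) ->
  0 < A -> x ^ 2 < PI -> continuous (kern phi A) x.
Proof.
intros; apply continuity_pt_continuous, continuity_2d_pt_section,
  continuity_2d_pt_kern; auto.
Qed.

Lemma ex_RInt_kern (phi : R -> R) (A th : R) :
  (forall s, continuity_pt phi s) -> (forall s, 0 < s -> lipschitz_near phi s) ->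
  0 < A -> Rabs th < PI / 2 -> ex_RInt (kern phi A) 0 (sqrt (PI / 2 - Rabs th)).
Proof.
intros Hc Hl HA Hth; apply (ex_RInt_continuous (kern phi A)); intros z.
rewrite Rmin_left, Rmax_right by apply sqrt_pos; intros Hz.
apply kern_continuous; auto; generalize (sqrt_sq_lt_PI th z Hth Hz) PI_half_gt_1; lra.
Qed.

(** [kern] is linear in [phi], so differentiating it in [A] replaces [H] by [l / A]. Passing the
    derivative under the integral needs joint continuity of [kern l], and here the Lipschitz
    property of [l] is used. *)
Lemma is_derive_kern_int_A (H l p : R -> R) (A th : R) :
  hubble_profile H l p -> 0 < A -> Rabs th < PI / 2 ->
  is_derive (fun u => kern_int H u th) A (kern_int l A th / A).
Proof.
intros HP HA Hth.
assert (HX := sqrt_pos (PI / 2 - Rabs th)).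
assert (D : forall u x, 0 < u -> is_derive (fun u => kern H u x) u (kern l u x / u)).
{ intros u x Hu; unfold kern.
  (* [H u] is written as [H (u * 1)] so that the scaling rule covers both terms. *)
  replace (2 * x * (l (u * cos (x ^ 2)) - cos (x ^ 2) * l u) / sin (x ^ 2) ^ 2 / u)
    with (scal (2 * x / sin (x ^ 2) ^ 2)
           (minus (l (u * cos (x ^ 2)) / u) (scal (cos (x ^ 2)) (l (u * 1) / u)))).
  2:{ rewrite Rmult_1_r; unfold minus, scal, plus, opp; simpl; unfold mult; simpl.
      unfold Rdiv; ring. }
  apply is_derive_ext with (fun u => scal (2 * x / sin (x ^ 2) ^ 2)
     (minus (H (u * cos (x ^ 2))) (scal (cos (x ^ 2)) (H (u * 1))))).
  { intros t; rewrite Rmult_1_r; unfold minus, scal, plus, opp; simpl; unfold mult; simpl.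
    unfold Rdiv; ring. }
  apply (is_derive_scal (fun u => minus (H (u * cos (x ^ 2))) (scal (cos (x ^ 2)) (H (u * 1))))).
  apply (is_derive_minus (fun u => H (u * cos (x ^ 2))) (fun u => scal (cos (x ^ 2)) (H (u * 1)))).
  - apply (is_derive_profile_scale _ _ _ _ _ HP); auto.
  - apply (is_derive_scal (fun u => H (u * 1))).
    apply (is_derive_profile_scale _ _ _ _ _ HP); auto. }
unfold kern_int.
replace (RInt (kern l A) 0 (sqrt (PI / 2 - Rabs th)) / A)
  with (RInt (fun t => Derive (fun u => kern H u t) A) 0 (sqrt (PI / 2 - Rabs th))).
- apply (is_derive_RInt_param (kern H)).
  + apply filter_imp with (2 := locally_pos A HA); intros u Hu t _.
    exists (kern l u t / u); auto.
  + rewrite Rmin_left, Rmax_right by auto; intros t Ht.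
    apply continuity_2d_pt_ext_loc with (fun u v => kern l u v / u).
    * exists (mkposreal _ HA); simpl; intros u v Hu _; symmetry; apply is_derive_unique, D.
      revert Hu; unfold Rabs; destruct Rcase_abs; lra.
    * apply (continuity_2d_pt_mult (kern l) (fun u _ => / u)).
      -- apply continuity_2d_pt_kern; auto; try apply HP; auto.
         generalize (sqrt_sq_lt_PI th t Hth Ht) PI_half_gt_1; lra.
      -- apply (continuity_2d_pt_inv (fun u _ => u)); [apply continuity_2d_pt_id1|lra].
  + apply filter_imp with (2 := locally_pos A HA); intros u Hu.
    apply ex_RInt_kern; auto; apply HP.
- rewrite (RInt_ext _ (fun x => scal (/ A) (kern l A x))).
  + eapply eq_trans; [apply (RInt_scal (kern l A)); apply ex_RInt_kern; auto; apply HP|].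
    unfold scal; simpl; unfold mult; simpl; field; lra.
  + intros x _; eapply eq_trans; [apply is_derive_unique, D; auto|].
    unfold scal; simpl; unfold mult; simpl; unfold Rdiv; ring.
Qed.

Lemma kern_int_opp (phi : R -> R) (A th : R) : kern_int phi A (- th) = kern_int phi A th.
Proof. unfold kern_int; now rewrite Rabs_Ropp. Qed.

Lemma is_derive_kern_int_th (phi : R -> R) (A th : R) :
  (forall s, continuity_pt phi s) -> (forall s, 0 < s -> lipschitz_near phi s) ->
  0 < A -> 0 < th < PI / 2 ->
  is_derive (kern_int phi A) th (- ((phi (A * sin th) - sin th * phi A) / cos th ^ 2)).
Proof.
intros Hc Hl HA Hth.
assert (Hab : Rabs th < PI / 2) by (rewrite Rabs_pos_eq; lra).
apply is_derive_ext_loc with (fun t => RInt (kern phi A) 0 (sqrt (PI / 2 - t))).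
{ apply filter_imp with (2 := locally_pos th (proj1 Hth)); intros t Ht.
  unfold kern_int; rewrite Rabs_pos_eq; auto; lra. }
set (X := sqrt (PI / 2 - th)).
assert (HX : 0 < X) by (apply sqrt_lt_R0; lra).
assert (X2 : X ^ 2 = PI / 2 - th) by (apply pow2_sqrt; lra).
assert (Hcos : 0 < cos th) by (apply cos_gt_0; lra).
(* The derivative [- / (2 * X)] of the upper limit cancels the Jacobian [2 * X] inside [kern]. *)
replace (- ((phi (A * sin th) - sin th * phi A) / cos th ^ 2))
  with (scal (- / (2 * X)) (kern phi A X)).
2:{ unfold kern; rewrite X2, sin_shift, cos_shift.
    unfold scal; simpl; unfold mult; simpl; field; lra. }
apply (is_derive_comp (RInt (kern phi A) 0) (fun t => sqrt (PI / 2 - t))).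
- assert (HXP : X ^ 2 < PI) by (rewrite X2; lra).
  apply (is_derive_RInt (kern phi A) _ 0); [|apply kern_continuous; auto].
  assert (Hlt : X < sqrt PI).
  { apply sqrt_lt_1; lra. }
  assert (L := filter_and _ _ (open_lt (sqrt PI) X Hlt) (open_gt 0 X HX)).
  apply filter_imp with (2 := L); intros b [Hb Hb0].
  apply (RInt_correct (kern phi A)), (ex_RInt_continuous (kern phi A)).
  rewrite Rmin_left, Rmax_right by lra; intros z Hz; apply kern_continuous; auto.
  rewrite <- (pow2_sqrt PI) by lra.
  assert (0 < (sqrt PI - z) * (sqrt PI + z)) by (apply Rmult_lt_0_compat; lra); lra.
- auto_derive; [lra|]; change (PI / 2 + - th) with (PI / 2 - th); fold X; field; lra.
Qed.

Lemma continuity_2d_pt_kern_int (phi : R -> R) (A th : R) :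
  (forall s, continuity_pt phi s) -> (forall s, 0 < s -> lipschitz_near phi s) ->
  0 < A -> Rabs th < PI / 2 -> continuity_2d_pt (kern_int phi) A th.
Proof.
intros Hc Hl HA Hth; unfold kern_int.
assert (HP := PI_half_gt_1).
apply (continuity_2d_pt_comp2 (fun A X => RInt (kern phi A) 0 X)
  (fun u _ => u) (fun _ v => sqrt (PI / 2 - Rabs v))).
- assert (HX := sqrt_pos (PI / 2 - Rabs th)).
  assert (HX2 : sqrt (PI / 2 - Rabs th) <= sqrt (PI / 2)).
  { apply sqrt_le_1_alt; generalize (Rabs_pos th); lra. }
  assert (HPP : sqrt (PI / 2) < sqrt PI) by (apply sqrt_lt_1; lra).
  (* The kernel is continuous as long as [x ^ 2 < PI], hence beyond the largest possible upper limit
     [sqrt (PI / 2)]; the distance to [sqrt PI] is the available margin. *)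
  assert (Hd : 0 < Rmin A (sqrt PI - sqrt (PI / 2))) by (apply Rmin_pos; lra).
  assert (L1 := Rmin_l A (sqrt PI - sqrt (PI / 2))).
  assert (L2 := Rmin_r A (sqrt PI - sqrt (PI / 2))).
  assert (H0 := sqrt_pos (PI / 2)).
  set (d := Rmin A (sqrt PI - sqrt (PI / 2))) in *.
  apply continuity_2d_pt_RInt with (d := d); auto.
  rewrite Rmin_left, Rmax_right by auto; intros B x HB Hx.
  assert (0 < B) by (revert HB; unfold Rabs; destruct Rcase_abs; lra).
  apply continuity_2d_pt_kern; auto.
  rewrite <- (pow2_sqrt PI) by lra.
  assert (0 < (sqrt PI - x) * (sqrt PI + x)) by (apply Rmult_lt_0_compat; lra); lra.
- apply continuity_2d_pt_id1.
- apply (continuity_2d_pt_snd (fun v => sqrt (PI / 2 - Rabs v))).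
  apply continuity_pt_filterlim, (continuous_sqrt_comp (fun v => PI / 2 - Rabs v)).
  apply (continuous_minus (fun _ => PI / 2) Rabs); [apply continuous_const|].
  apply continuous_Rabs.
Qed.

Lemma continuity_2d_pt_cos_snd (u v : R) : continuity_2d_pt (fun _ v => cos v) u v.
Proof. apply continuity_2d_pt_snd, continuity_cos. Qed.

Lemma continuity_2d_pt_inv_fst (u v : R) : u <> 0 -> continuity_2d_pt (fun u _ => / u) u v.
Proof. intros; apply continuity_2d_pt_inv; auto; apply continuity_2d_pt_id1. Qed.

Lemma continuity_2d_pt_half_shift (H l p : R -> R) (A th : R) :
  hubble_profile H l p -> 0 < A -> Rabs th < PI / 2 ->
  continuity_2d_pt (half_shift H) A th.
Proof.
intros HP HA Hth; unfold half_shift, Rdiv.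
apply (continuity_2d_pt_mult (fun A th => cos th * kern_int H A th) (fun A _ => / A)).
- apply (continuity_2d_pt_mult (fun _ th => cos th)); [apply continuity_2d_pt_cos_snd|].
  apply continuity_2d_pt_kern_int; auto; apply HP.
- apply continuity_2d_pt_inv_fst; lra.
Qed.

Lemma continuity_2d_pt_half_shift_A (H l p : R -> R) (A th : R) :
  hubble_profile H l p -> 0 < A -> Rabs th < PI / 2 ->
  continuity_2d_pt (half_shift_A H l) A th.
Proof.
intros HP HA Hth; unfold half_shift_A, Rdiv.
apply (continuity_2d_pt_mult
  (fun A th => cos th * (kern_int l A th - kern_int H A th)) (fun A _ => / A ^ 2)).
- apply (continuity_2d_pt_mult (fun _ th => cos th)); [apply continuity_2d_pt_cos_snd|].
  apply continuity_2d_pt_minus; apply continuity_2d_pt_kern_int; auto; apply HP.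
- apply (continuity_2d_pt_inv (fun A _ => A ^ 2)).
  + apply (continuity_2d_pt_fst (fun x => x ^ 2)), continuity_pt_pow2.
  + apply Rgt_not_eq, pow_lt; auto.
Qed.

(** * Reflection in the angle *)

Lemma Rabs_pos_part (th c : R) : Rabs th < c -> Rabs ((th + Rabs th) / 2) < c.
Proof. unfold Rabs; repeat destruct Rcase_abs; lra. Qed.

Lemma Rabs_neg_part (th c : R) : Rabs th < c -> Rabs ((th - Rabs th) / 2) < c.
Proof. unfold Rabs; repeat destruct Rcase_abs; lra. Qed.

Lemma continuity_2d_pt_odd_reflection (q : R -> R -> R) (A th c : R) :
  (forall t, Rabs t < c -> continuity_2d_pt q A t) -> Rabs th < c ->
  continuity_2d_pt (fun A th => odd_reflection (q A) th) A th.
Proof.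
intros Hq Hth; unfold odd_reflection.
assert (CA : forall t, continuity_pt Rabs t).
{ intros t; apply continuity_pt_filterlim, continuous_Rabs. }
assert (Ci : forall t : R, continuity_pt (fun t => t) t).
{ intros t; apply (is_derive_continuity_pt (fun t => t) t 1); auto_derive; auto. }
assert (Ch : forall t, continuity_pt (fun _ => / 2) t) by (intros; apply continuity_pt_const; intro; auto).
apply (continuity_2d_pt_minus (fun A th => q A ((th + Rabs th) / 2) + q A 0)
         (fun A th => q A ((th - Rabs th) / 2))).
- apply (continuity_2d_pt_plus (fun A th => q A ((th + Rabs th) / 2)) (fun A th => q A 0)).
  + apply (continuity_2d_pt_comp2 q (fun u _ => u) (fun _ th => (th + Rabs th) / 2)).
    * apply Hq, Rabs_pos_part; auto.
    * apply continuity_2d_pt_id1.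
    * apply (continuity_2d_pt_snd (fun th => (th + Rabs th) / 2)).
      apply (continuity_pt_mult (fun th => th + Rabs th) (fun _ => / 2)); auto.
      apply (continuity_pt_plus (fun th => th) Rabs); auto.
  + apply (continuity_2d_pt_comp2 q (fun u _ => u) (fun _ _ => 0)).
    * apply Hq; rewrite Rabs_R0; generalize (Rabs_pos th); lra.
    * apply continuity_2d_pt_id1.
    * apply continuity_2d_pt_const.
- apply (continuity_2d_pt_comp2 q (fun u _ => u) (fun _ th => (th - Rabs th) / 2)).
  + apply Hq, Rabs_neg_part; auto.
  + apply continuity_2d_pt_id1.
  + apply (continuity_2d_pt_snd (fun th => (th - Rabs th) / 2)).
    apply (continuity_pt_mult (fun th => th - Rabs th) (fun _ => / 2)); auto.
    apply (continuity_pt_minus (fun th => th) Rabs); auto.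
Qed.

Lemma is_derive_half_shift_A (H l p : R -> R) (A th : R) :
  hubble_profile H l p -> 0 < A -> Rabs th < PI / 2 ->
  is_derive (fun u => half_shift H u th) A (half_shift_A H l A th).
Proof.
intros HP HA Hth; unfold half_shift, half_shift_A.
assert (D := is_derive_kern_int_A _ _ _ _ _ HP HA Hth).
auto_derive.
- split; [eexists; exact D|split; auto; lra].
- replace (Derive (fun x => kern_int H x th) A) with (kern_int l A th / A)
    by (symmetry; apply is_derive_unique; exact D).
  field; lra.
Qed.

Lemma is_derive_odd_reflection_A (q dq : R -> R -> R) (A th c : R) :
  (forall t, Rabs t < c -> is_derive (fun u => q u t) A (dq A t)) -> Rabs th < c ->
  is_derive (fun u => odd_reflection (q u) th) A (odd_reflection (dq A) th).
Proof.
intros Hq Hth; unfold odd_reflection.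
apply (is_derive_minus (fun u => q u ((th + Rabs th) / 2) + q u 0)
         (fun u => q u ((th - Rabs th) / 2))).
- apply (is_derive_plus (fun u => q u ((th + Rabs th) / 2)) (fun u => q u 0)); apply Hq.
  + apply Rabs_pos_part; auto.
  + rewrite Rabs_R0; generalize (Rabs_pos th); lra.
- apply Hq, Rabs_neg_part; auto.
Qed.

Lemma odd_reflection_nonneg (q : R -> R) (th : R) : 0 <= th -> odd_reflection q th = q th.
Proof.
intros Hth; unfold odd_reflection; rewrite Rabs_pos_eq by auto.
replace ((th + th) / 2) with th by field; replace ((th - th) / 2) with 0 by field; ring.
Qed.

Lemma odd_reflection_neg (q : R -> R) (th : R) :
  th <= 0 -> odd_reflection q th = 2 * q 0 - q th.
Proof.
intros Hth; unfold odd_reflection; rewrite Rabs_left1 by auto.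
replace ((th + - th) / 2) with 0 by field; replace ((th - - th) / 2) with th by field; ring.
Qed.

Lemma cos_pos_of_abs (th : R) : Rabs th < PI / 2 -> 0 < cos th.
Proof. intros; apply cos_gt_0; revert H; unfold Rabs; destruct Rcase_abs; lra. Qed.

Lemma continuity_2d_pt_A_sin (f : R -> R) (A th : R) :
  (forall s, continuity_pt f s) -> continuity_2d_pt (fun A th => f (A * sin th)) A th.
Proof.
intros Hf; apply (continuity_1d_2d_pt_comp f (fun A th => A * sin th)); auto.
apply (continuity_2d_pt_mult (fun A _ => A) (fun _ th => sin th)).
- apply continuity_2d_pt_id1.
- apply continuity_2d_pt_snd, continuity_sin.
Qed.

Lemma continuity_2d_pt_shift_slope (H l p : R -> R) (A th : R) :
  hubble_profile H l p -> 0 < A -> Rabs th < PI / 2 ->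
  continuity_2d_pt (shift_slope H p) A th.
Proof.
intros HP HA Hth; unfold shift_slope, Rdiv.
assert (Hc := cos_pos_of_abs th Hth).
assert (Ci : continuity_2d_pt (fun _ th => / cos th) A th).
{ apply (continuity_2d_pt_inv (fun _ th => cos th)); [apply continuity_2d_pt_cos_snd|lra]. }
assert (Ai : continuity_2d_pt (fun A _ => / A) A th) by (apply continuity_2d_pt_inv_fst; lra).
apply (continuity_2d_pt_mult (fun A th => p (A * sin th) * / A *
   (kern_int H A th - H A * / cos th) + / cos th) (fun A _ => / A)); auto.
apply (continuity_2d_pt_plus (fun A th => p (A * sin th) * / A *
   (kern_int H A th - H A * / cos th)) (fun _ th => / cos th)); auto.
apply (continuity_2d_pt_mult (fun A th => p (A * sin th) * / A)
   (fun A th => kern_int H A th - H A * / cos th)).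
- apply (continuity_2d_pt_mult (fun A th => p (A * sin th)) (fun A _ => / A)); auto.
  apply continuity_2d_pt_A_sin, HP.
- apply (continuity_2d_pt_minus (kern_int H) (fun A th => H A * / cos th)).
  + apply continuity_2d_pt_kern_int; auto; apply HP.
  + apply (continuity_2d_pt_mult (fun A _ => H A) (fun _ th => / cos th)); auto.
    apply continuity_2d_pt_fst, HP.
Qed.

Lemma is_derive_half_shift_th (H l p : R -> R) (A th : R) :
  hubble_profile H l p -> 0 < A -> 0 < th < PI / 2 ->
  is_derive (half_shift H A) th (- shift_slope H p A th * H (A * sin th)).
Proof.
intros HP HA Hth; unfold half_shift.
assert (Hs : 0 < sin th) by (apply sin_gt_0; generalize PI_half_gt_1; lra).
assert (Hc : 0 < cos th) by (apply cos_gt_0; lra).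
assert (Hp := hp_p_H _ _ _ HP (A * sin th) (Rmult_lt_0_compat _ _ HA Hs)).
assert (D := is_derive_kern_int_th H A th (hp_cont_H _ _ _ HP) (hp_lip_H _ _ _ HP) HA Hth).
auto_derive.
- eexists; exact D.
- replace (Derive (fun x => kern_int H A x) th)
    with (- ((H (A * sin th) - sin th * H A) / cos th ^ 2))
    by (symmetry; apply is_derive_unique; exact D).
  unfold shift_slope.
  replace (- ((p (A * sin th) / A * (kern_int H A th - H A / cos th) + / cos th) / A) * H (A * sin th))
    with (- (((p (A * sin th) * H (A * sin th)) / A * (kern_int H A th - H A / cos th)
              + H (A * sin th) / cos th) / A)) by (field; lra).
  rewrite Hp; field; lra.
Qed.

Lemma half_shift_opp (H : R -> R) (A th : R) : half_shift H A (- th) = half_shift H A th.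
Proof. unfold half_shift; now rewrite kern_int_opp, cos_neg. Qed.

Lemma shift_slope_opp (H l p : R -> R) (A th : R) :
  hubble_profile H l p -> shift_slope H p A (- th) = shift_slope H p A th.
Proof.
intros HP; unfold shift_slope.
now rewrite kern_int_opp, cos_neg, sin_neg, Ropp_mult_distr_r_reverse, (hp_even_p _ _ _ HP).
Qed.

(** [shift_slope] is even in the angle and [H] is even, so the two branches of the reflection obey
    the same formula. Its right-hand side is continuous at 0, and [is_derive_extend] carries it
    across that point. *)
Lemma is_derive_shift_th (H l p : R -> R) (A th : R) :
  hubble_profile H l p -> 0 < A -> Rabs th < PI / 2 ->
  is_derive (odd_reflection (half_shift H A)) th (- shift_slope H p A th * H (A * sin th)).
Proof.
intros HP HA Hth.
assert (D : forall t, Rabs t < PI / 2 -> t <> 0 ->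
  is_derive (odd_reflection (half_shift H A)) t (- shift_slope H p A t * H (A * sin t))).
{ clear th Hth; intros t Ht Hn; destruct (Rtotal_order t 0) as [Hneg|[->|Hpos]]; [|lra|].
  - rewrite <- (shift_slope_opp _ _ _ _ _ HP), <- (hp_even_H _ _ _ HP (A * sin t)).
    replace (- (A * sin t)) with (A * sin (- t)) by (rewrite sin_neg; ring).
    assert (Ht' : 0 < - t < PI / 2) by (revert Ht; unfold Rabs; destruct Rcase_abs; lra).
    apply is_derive_ext_loc with (fun t => 2 * half_shift H A 0 - half_shift H A (- t)).
    { apply filter_imp with (2 := open_lt 0 t Hneg); intros u Hu.
      rewrite odd_reflection_neg, half_shift_opp by lra; auto. }
    assert (D := is_derive_half_shift_th _ _ _ A (- t) HP HA Ht').
    auto_derive; [eexists; exact D|].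
    replace (Derive (fun x => half_shift H A x) (- t))
      with (- shift_slope H p A (- t) * H (A * sin (- t)))
      by (symmetry; apply is_derive_unique; exact D).
    ring.
  - apply is_derive_ext_loc with (half_shift H A).
    { apply filter_imp with (2 := open_gt 0 t Hpos); intros u Hu.
      rewrite odd_reflection_nonneg by lra; auto. }
    apply is_derive_half_shift_th with l; auto.
    revert Ht; unfold Rabs; destruct Rcase_abs; lra. }
destruct (Req_dec th 0) as [->|N]; [|auto].
assert (HP1 := PI_half_gt_1).
apply (is_derive_extend (odd_reflection (half_shift H A))
   (fun th => - shift_slope H p A th * H (A * sin th)) 0 1).
- lra.
- apply (continuity_2d_pt_section (fun A => odd_reflection (half_shift H A)) A 0).
  apply continuity_2d_pt_odd_reflection with (PI / 2); auto.
  intros t Ht; apply continuity_2d_pt_half_shift with l p; auto.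
- intros t Ht Hn; rewrite Rminus_0_r in Ht; apply D; auto; lra.
- apply (continuity_pt_mult (fun th => - shift_slope H p A th) (fun th => H (A * sin th))).
  + apply continuity_pt_opp, continuity_2d_pt_section, continuity_2d_pt_shift_slope with l; auto.
  + apply (continuity_2d_pt_section (fun A th => H (A * sin th))).
    apply continuity_2d_pt_A_sin, HP.
Qed.

(** * The distance integral and its comparison with the shift *)

Lemma ex_RInt_A_sin (f : R -> R) (A u v : R) :
  (forall s, continuity_pt f s) -> ex_RInt (fun x => f (A * sin x)) u v.
Proof.
intros Hf; apply (ex_RInt_continuous (fun x => f (A * sin x))); intros z _.
apply continuity_pt_continuous, (continuity_2d_pt_section (fun A th => f (A * sin th))),
  continuity_2d_pt_A_sin; auto.
Qed.

Lemma continuity_2d_pt_dist_int (f : R -> R) (A th : R) :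
  (forall s, continuity_pt f s) -> continuity_2d_pt (dist_int f) A th.
Proof.
intros Hf; apply continuity_2d_pt_ext with
  (fun A th => - RInt (fun x => f (A * sin x)) (PI / 2) th).
- intros B t; unfold dist_int.
  apply (opp_RInt_swap (fun x => f (B * sin x))), ex_RInt_A_sin; auto.
- apply continuity_2d_pt_opp.
  apply (continuity_2d_pt_RInt (fun A x => f (A * sin x)) _ _ _ 1); [lra|].
  intros; apply continuity_2d_pt_A_sin; auto.
Qed.

Lemma is_derive_dist_int_th (f : R -> R) (A th : R) :
  (forall s, continuity_pt f s) -> is_derive (dist_int f A) th (- f (A * sin th)).
Proof.
intros Hf; apply (is_derive_RInt' (fun x => f (A * sin x)) (dist_int f A) th (PI / 2)).
- apply filter_forall; intros u; apply (RInt_correct (fun x => f (A * sin x))).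
  apply ex_RInt_A_sin; auto.
- apply continuity_pt_continuous, (continuity_2d_pt_section (fun A th => f (A * sin th))),
  continuity_2d_pt_A_sin; auto.
Qed.

Lemma is_derive_dist_int_A (H l p : R -> R) (A th : R) :
  hubble_profile H l p -> 0 < A ->
  is_derive (fun u => dist_int H u th) A (dist_int l A th / A).
Proof.
intros HP HA; unfold dist_int.
assert (D : forall u x, 0 < u -> is_derive (fun u => H (u * sin x)) u (l (u * sin x) / u)).
{ intros u x Hu; apply is_derive_profile_scale with p; auto. }
replace (RInt (fun x => l (A * sin x)) th (PI / 2) / A)
  with (RInt (fun t => Derive (fun u => H (u * sin t)) A) th (PI / 2)).
- apply (is_derive_RInt_param (fun u x => H (u * sin x))).
  + apply filter_imp with (2 := locally_pos A HA); intros u Hu t _.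
    eexists; apply D; auto.
  + intros t _; apply continuity_2d_pt_ext_loc with (fun u v => l (u * sin v) / u).
    * exists (mkposreal _ HA); simpl; intros u v Hu _; symmetry; apply is_derive_unique, D.
      revert Hu; unfold Rabs; destruct Rcase_abs; lra.
    * apply (continuity_2d_pt_mult (fun u v => l (u * sin v)) (fun u _ => / u)).
      -- apply continuity_2d_pt_A_sin, HP.
      -- apply continuity_2d_pt_inv_fst; lra.
  + apply filter_forall; intros u; apply ex_RInt_A_sin, HP.
- rewrite (RInt_ext _ (fun x => scal (/ A) (l (A * sin x)))).
  + eapply eq_trans; [apply (RInt_scal (fun x => l (A * sin x))); apply ex_RInt_A_sin, HP|].
    unfold scal; simpl; unfold mult; simpl; field; lra.
  + intros x _; eapply eq_trans; [apply is_derive_unique, D; auto|].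
    unfold scal; simpl; unfold mult; simpl; unfold Rdiv; ring.
Qed.

Lemma dist_int_PI2 (H : R -> R) (A : R) : dist_int H A (PI / 2) = 0.
Proof. apply (RInt_point (V := R_CompleteNormedModule)). Qed.

Lemma hp_H_nonneg (H l p : R -> R) (s : R) : hubble_profile H l p -> 0 <= H s.
Proof.
intros HP; destruct (Rtotal_order s 0) as [Hs|[->|Hs]].
- rewrite <- (hp_even_H _ _ _ HP); apply Rlt_le, (hp_H_pos _ _ _ HP); lra.
- rewrite (hp_H0 _ _ _ HP); lra.
- apply Rlt_le, (hp_H_pos _ _ _ HP); lra.
Qed.

Lemma dist_int_decr (H l p : R -> R) (A u v : R) :
  hubble_profile H l p -> u <= v -> dist_int H A v <= dist_int H A u.
Proof.
intros HP Huv.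
assert (T : - dist_int H A u <= - dist_int H A v); [|lra].
apply (derive_nonneg_le (fun x => - dist_int H A x) (fun x => H (A * sin x))); auto.
- intros t _; replace (H (A * sin t)) with (- - H (A * sin t)) by ring.
  apply (is_derive_opp (dist_int H A)), is_derive_dist_int_th, HP.
- intros t _; apply continuity_pt_opp, continuity_2d_pt_section, continuity_2d_pt_dist_int, HP.
- intros t _; apply hp_H_nonneg with l p; auto.
Qed.

(** The derivative vanishes at angle 0, so the mean value theorem is strict only on intervals lying
    on one side of 0. An interval straddling 0 is cut there, and weak monotonicity suffices on one
    half. *)
Lemma dist_int_strict_decr (H l p : R -> R) (A u v : R) :
  hubble_profile H l p -> 0 < A -> - (PI / 2) <= u -> u < v -> v <= PI / 2 ->
  dist_int H A v < dist_int H A u.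
Proof.
intros HP HA Hu Huv Hv; assert (HP1 := PI_half_gt_1).
assert (S : forall u v, - (PI / 2) <= u -> u < v -> v <= PI / 2 -> 0 <= u \/ v <= 0 ->
   dist_int H A v < dist_int H A u).
{ clear u v Hu Huv Hv; intros u v Hu Huv Hv Hs.
  destruct (MVT_cor2 (dist_int H A) (fun x => - H (A * sin x)) u v Huv) as [c [E Hc]].
  - intros c _; apply is_derive_Reals, is_derive_dist_int_th, HP.
  - assert (0 < H (A * sin c)).
    { destruct Hs as [Hs|Hs].
      - apply (hp_H_pos _ _ _ HP), Rmult_lt_0_compat; auto; apply sin_gt_0; lra.
      - rewrite <- (hp_even_H _ _ _ HP); apply (hp_H_pos _ _ _ HP).
        replace (- (A * sin c)) with (A * sin (- c)) by (rewrite sin_neg; ring).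
        apply Rmult_lt_0_compat; auto; apply sin_gt_0; lra. }
    assert (0 < H (A * sin c) * (v - u)) by (apply Rmult_lt_0_compat; lra); lra. }
destruct (Rle_dec 0 u) as [H1|H1]; [apply S; auto|].
destruct (Rle_dec v 0) as [H2|H2]; [apply S; auto|].
apply Rlt_le_trans with (dist_int H A 0); [apply S; lra|].
apply dist_int_decr with l p; auto; lra.
Qed.

(** Evenness of [H] makes the integral over [[- th, 0]] equal to the one over [[0, th]]. At
    [th = PI / 2] the identity recognises [2 * rhoM] as the value at [- (PI / 2)]. *)
Lemma dist_int_opp (H l p : R -> R) (A th : R) :
  hubble_profile H l p -> dist_int H A (- th) = 2 * dist_int H A 0 - dist_int H A th.
Proof.
intros HP; unfold dist_int.
assert (E : forall u v, ex_RInt (fun x => H (A * sin x)) u v)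
  by (intros; apply ex_RInt_A_sin, HP).
rewrite <- (RInt_Chasles (fun x => H (A * sin x)) (- th) 0 (PI / 2)) by apply E.
rewrite <- (RInt_Chasles (fun x => H (A * sin x)) 0 th (PI / 2)) by apply E.
assert (T : RInt (fun x => H (A * sin x)) (- th) 0 = RInt (fun x => H (A * sin x)) 0 th).
{ rewrite <- (opp_RInt_swap (fun x => H (A * sin x))) by apply E.
  apply eq_trans with (opp (RInt (fun y => scal (-1) (H (A * sin (-1 * y + 0)))) 0 th)).
  - f_equal; symmetry.
    replace (- th) with (-1 * th + 0) by ring; replace 0 with (-1 * 0 + 0) at 2 by ring.
    apply (RInt_comp_lin (fun x => H (A * sin x)) (-1) 0 0 th).
    replace (-1 * 0 + 0) with 0 by ring; apply E.
  - rewrite <- (RInt_opp (fun y => scal (-1) (H (A * sin (-1 * y + 0))))).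
    + apply RInt_ext; intros x _; unfold scal, opp; simpl; unfold mult; simpl.
      replace (-1 * x + 0) with (- x) by ring.
      rewrite sin_neg, Ropp_mult_distr_r_reverse, (hp_even_H _ _ _ HP); ring.
    + apply (ex_RInt_comp_lin (fun x => H (A * sin x)) (-1) 0); apply E. }
rewrite T; unfold plus; simpl; ring.
Qed.

(** The angle derivatives of shift and distance share the factor [H (u * sin x) >= 0]. Hence
    [P - (g + eps) * S] increases and [P - (g - eps) * S] decreases wherever [shift_slope] is within
    [eps] of [g]. No division by [H] occurs, so [th = 0] is included, and joint continuity of
    [shift_slope] makes the estimate uniform in [u]. *)
Lemma shift_increment (H l p : R -> R) (A th eps : R) :
  hubble_profile H l p -> 0 < A -> Rabs th < PI / 2 -> 0 < eps ->
  exists d, 0 < d /\ forall u t, Rabs (u - A) < d -> Rabs (t - th) < d ->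
    Rabs (odd_reflection (half_shift H u) t - odd_reflection (half_shift H u) th
          - shift_slope H p A th * (dist_int H u t - dist_int H u th))
      <= eps * Rabs (dist_int H u t - dist_int H u th).
Proof.
intros HP HA Hth Heps.
destruct (continuity_2d_pt_shift_slope _ _ _ A th HP HA Hth (mkposreal _ Heps)) as [d1 H1].
simpl in H1.
assert (Hd : 0 < Rmin d1 (Rmin A (PI / 2 - Rabs th))).
{ repeat apply Rmin_pos; auto; try apply cond_pos; lra. }
exists (Rmin d1 (Rmin A (PI / 2 - Rabs th))); split; auto.
assert (L1 := Rmin_l d1 (Rmin A (PI / 2 - Rabs th))).
assert (L2 := Rmin_r d1 (Rmin A (PI / 2 - Rabs th))).
assert (L3 := Rmin_l A (PI / 2 - Rabs th)); assert (L4 := Rmin_r A (PI / 2 - Rabs th)).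
set (d := Rmin d1 (Rmin A (PI / 2 - Rabs th))) in *; intros u t Hu Ht.
set (P := odd_reflection (half_shift H u)); set (S := dist_int H u).
set (g := shift_slope H p A th) in *.
assert (Hu0 : 0 < u) by (revert Hu; unfold Rabs; destruct Rcase_abs; lra).
assert (Dm : forall x, Rabs (x - th) < d -> Rabs x < PI / 2).
{ intros x Hx; assert (T := Rabs_triang (x - th) th).
  replace (x - th + th) with x in T by ring; lra. }
assert (DP : forall k x, Rabs (x - th) < d ->
  is_derive (fun x => P x - k * S x) x ((k - shift_slope H p u x) * H (u * sin x))).
{ intros k x Hx; assert (D1 := is_derive_shift_th _ _ _ u x HP Hu0 (Dm x Hx)).
  assert (D2 := is_derive_dist_int_th H u x (hp_cont_H _ _ _ HP)).
  fold P in D1; fold S in D2.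
  replace ((k - shift_slope H p u x) * H (u * sin x))
    with (minus (- shift_slope H p u x * H (u * sin x)) (k * - H (u * sin x)))
    by (unfold minus, plus, opp; simpl; ring).
  apply (is_derive_minus P (fun x => k * S x)); auto.
  apply (is_derive_scal S); auto. }
assert (B : forall x, Rabs (x - th) < d -> - eps < shift_slope H p u x - g < eps).
{ intros x Hx; generalize (Rabs_def2 _ _ (H1 u x ltac:(lra) ltac:(lra))); lra. }
assert (Hn : forall x, 0 <= H (u * sin x)) by (intros; apply hp_H_nonneg with l p; auto).
assert (M : forall x y, x <= y -> Rabs (x - th) < d -> Rabs (y - th) < d ->
  Rabs (P y - P x - g * (S y - S x)) <= eps * (S x - S y)).
{ intros x y Hxy Hx Hy.
  assert (Bt : forall z, x <= z <= y -> Rabs (z - th) < d).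
  { intros z Hz; revert Hx Hy; unfold Rabs; repeat destruct Rcase_abs; lra. }
  assert (I1 : P x - (g + eps) * S x <= P y - (g + eps) * S y).
  { apply (derive_nonneg_le (fun x => P x - (g + eps) * S x)
      (fun x => (g + eps - shift_slope H p u x) * H (u * sin x))); auto.
    - intros z Hz; apply DP, Bt; lra.
    - intros z Hz; eapply is_derive_continuity_pt, DP, Bt; auto.
    - intros z Hz; apply Rmult_le_pos; auto; generalize (B z (Bt z Hz)); lra. }
  assert (I2 : - (P x - (g - eps) * S x) <= - (P y - (g - eps) * S y)).
  { apply (derive_nonneg_le (fun x => - (P x - (g - eps) * S x))
      (fun x => - ((g - eps - shift_slope H p u x) * H (u * sin x)))); auto.
    - intros z Hz; apply (is_derive_opp (fun x => P x - (g - eps) * S x)), DP, Bt; lra.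
    - intros z Hz; apply continuity_pt_opp; eapply is_derive_continuity_pt, DP, Bt; auto.
    - intros z Hz; rewrite Ropp_mult_distr_l; apply Rmult_le_pos; auto.
      generalize (B z (Bt z Hz)); lra. }
  apply Rabs_le; lra. }
assert (Hthd : Rabs (th - th) < d) by (rewrite Rminus_diag, Rabs_R0; auto).
destruct (Rle_dec th t) as [Hle|Hle].
- apply Rle_trans with (1 := M th t Hle Hthd Ht).
  rewrite Rabs_minus_sym; apply Rmult_le_compat_l; [lra|apply Rle_abs].
- replace (P t - P th - g * (S t - S th)) with (- (P th - P t - g * (S th - S t))) by ring.
  rewrite Rabs_Ropp; apply Rle_trans with (1 := M t th ltac:(lra) Ht Hthd).
  apply Rmult_le_compat_l; [lra|apply Rle_abs].
Qed.

(** * The Hubble profile of a scale factor *)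

(** The negative of the deceleration parameter of cosmology; the Hubble radius grows in time at the
    rate [1 - decel]. *)
Definition decel (a : R -> R) (t : R) : R := a t * addot a t / adot a t ^ 2.

(** Common ground of the two alternatives, with [L = 0] in the first. When [L = 0] the limit of
    [a / adot] is of the form 0/0, hence the separate field [ad_hub]. *)
Record admissible (a : R -> R) (K C L : R) : Prop := {
  ad_regular : strongly_regular_scale_factor a K;
  ad_limit : filterlim (adot a) (at_right 0) (locally L);
  ad_hub : filterlim (fun t => a t / adot a t) (at_right 0) (locally 0);
  ad_third : forall t, 0 < t -> ex_derive (addot a) t /\
     Rabs (adddot a t * a t ^ 2 / adot a t ^ 3) <= C }.

(** Unlike the even extension this one is injective on the whole line, so a single inverse and a
    single angle serve both signs of [t0]; its absolute value is the even extension. *)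
Definition aodd (a : R -> R) (t : R) : R := if Rle_dec 0 t then a t else - a (- t).

(** The value at 0 is prescribed because [adot a 0] would depend on [a] at negative arguments, which
    are unconstrained. *)
Definition vel (a : R -> R) (L t : R) : R :=
  if Req_dec_T t 0 then L else adot a (Rabs t).

(** A two-sided inverse of [aodd]: the scale factor turns out to be unbounded, so every real number
    is attained. *)
Definition ainv (a : R -> R) (s : R) : R := epsilon (inhabits 0) (fun t => aodd a t = s).

(** At [t = 0] the numerator is 0, so the value is 0 even when [L = 0], in agreement with the limit
    in [ad_hub]. *)
Definition hub (a : R -> R) (L t : R) : R := Rabs (aodd a t) / vel a L t.

(** [s * dH/ds] at [s = a t]: the time derivative [1 - decel] of the Hubble radius, times
    [a / adot]. At 0 the factor [hub] vanishes, whatever value [decel] takes there. *)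
Definition hubl (a : R -> R) (L t : R) : R := hub a L t * (1 - decel a (Rabs t)).

(** * Signs, monotonicity and the odd extension of the scale factor *)

Lemma at_right_eps (f : R -> R) (x l eps : R) :
  filterlim f (at_right x) (locally l) -> 0 < eps ->
  exists d, 0 < d /\ forall t, x < t < x + d -> Rabs (f t - l) < eps.
Proof.
intros H He.
destruct (H (fun y => Rabs (y - l) < eps)) as [d Hd].
- exists (mkposreal _ He); intros y Hy; exact Hy.
- exists d; split; [apply cond_pos|]; intros t Ht; apply Hd; [|lra].
  change (Rabs (t - x) < d); rewrite Rabs_pos_eq; lra.
Qed.

Lemma is_derive_nonneg_of_incr (f : R -> R) (x l d : R) :
  0 < d -> (forall u, x < u < x + d -> f x <= f u) -> is_derive f x l -> 0 <= l.
Proof.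
intros Hd Hi D; destruct (Rle_dec 0 l) as [H|H]; auto.
destruct (is_derive_eps f x l (- l / 2) D) as [e [He E]]; [lra|].
assert (Hm : 0 < Rmin d e) by (apply Rmin_pos; auto).
assert (L1 := Rmin_l d e); assert (L2 := Rmin_r d e).
set (h := Rmin d e / 2); assert (Hh : 0 < h < Rmin d e) by (unfold h; lra).
specialize (Hi (x + h) ltac:(lra)).
specialize (E (x + h)); replace (x + h - x) with h in E by ring.
rewrite (Rabs_pos_eq h) in E by lra; specialize (E ltac:(lra)).
apply Rabs_le_between in E.
assert (0 < - l * h) by (apply Rmult_lt_0_compat; lra); lra.
Qed.

Lemma is_derive_a (a : R -> R) (K C L t : R) :
  admissible a K C L -> 0 < t -> is_derive a t (adot a t).
Proof. intros HA Ht; apply Derive_correct, (ad_regular _ _ _ _ HA); auto. Qed.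

Lemma is_derive_adot (a : R -> R) (K C L t : R) :
  admissible a K C L -> 0 < t -> is_derive (adot a) t (addot a t).
Proof. intros HA Ht; apply (Derive_correct (Derive a)), (ad_regular _ _ _ _ HA); auto. Qed.

Lemma is_derive_addot (a : R -> R) (K C L t : R) :
  admissible a K C L -> 0 < t -> is_derive (addot a) t (adddot a t).
Proof. intros HA Ht; apply (Derive_correct (addot a)), (ad_third _ _ _ _ HA); auto. Qed.

Lemma adot_pos (a : R -> R) (K C L t : R) : admissible a K C L -> 0 < t -> 0 < adot a t.
Proof.
intros HA Ht; destruct (ad_regular _ _ _ _ HA) as [[_ [Hi [_ [_ [Hn _]]]]] _].
assert (0 <= adot a t).
{ apply (is_derive_nonneg_of_incr a t (adot a t) 1); [lra| |eapply is_derive_a; eauto].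
  intros u Hu; apply Rlt_le, Hi; lra. }
specialize (Hn t Ht); lra.
Qed.

Lemma a_0 (a : R -> R) (K C L : R) : admissible a K C L -> a 0 = 0.
Proof. intros HA; apply (ad_regular _ _ _ _ HA). Qed.

Lemma a_incr (a : R -> R) (K C L s t : R) :
  admissible a K C L -> 0 <= s -> s < t -> a s < a t.
Proof. intros HA; apply (ad_regular _ _ _ _ HA). Qed.

Lemma a_pos (a : R -> R) (K C L t : R) : admissible a K C L -> 0 < t -> 0 < a t.
Proof.
intros HA Ht; rewrite <- (a_0 _ _ _ _ HA); apply (a_incr _ _ _ _ _ _ HA); lra.
Qed.

Lemma aodd_nonneg (a : R -> R) (t : R) : 0 <= t -> aodd a t = a t.
Proof. intros; unfold aodd; destruct (Rle_dec 0 t); auto; lra. Qed.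

Lemma aodd_opp (a : R -> R) (K C L t : R) :
  admissible a K C L -> aodd a (- t) = - aodd a t.
Proof.
intros HA; unfold aodd; destruct (Rle_dec 0 (- t)), (Rle_dec 0 t).
- replace t with 0 by lra; rewrite Ropp_0, (a_0 _ _ _ _ HA); ring.
- ring.
- now rewrite Ropp_involutive.
- lra.
Qed.

Lemma aodd_incr (a : R -> R) (K C L s t : R) :
  admissible a K C L -> s < t -> aodd a s < aodd a t.
Proof.
intros HA Hst; assert (Hi := fun s t => a_incr _ _ _ _ s t HA).
assert (H0 := a_0 _ _ _ _ HA).
unfold aodd; destruct (Rle_dec 0 s), (Rle_dec 0 t); try lra.
- apply Hi; lra.
- assert (H1 := a_pos _ _ _ _ (- s) HA ltac:(lra)).
  destruct (Req_dec t 0) as [->|N]; [lra|].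
  assert (H2 := a_pos _ _ _ _ t HA ltac:(lra)); lra.
- assert (H1 := Hi (- t) (- s) ltac:(lra) ltac:(lra)); lra.
Qed.

Lemma Rabs_aodd (a : R -> R) (K C L t : R) :
  admissible a K C L -> Rabs (aodd a t) = a (Rabs t).
Proof.
intros HA; unfold aodd.
assert (P : forall u, 0 <= u -> 0 <= a u).
{ intros u [Hu|<-]; [apply Rlt_le, (a_pos _ _ _ _ _ HA); auto|].
  rewrite (a_0 _ _ _ _ HA); lra. }
destruct (Rle_dec 0 t).
- rewrite !Rabs_pos_eq; auto.
- rewrite Rabs_Ropp, (Rabs_left t) by lra; apply Rabs_pos_eq, P; lra.
Qed.

Lemma vel_neq0 (a : R -> R) (L t : R) : t <> 0 -> vel a L t = adot a (Rabs t).
Proof. intros; unfold vel; destruct (Req_dec_T t 0); auto; lra. Qed.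

Lemma vel_pos (a : R -> R) (K C L t : R) : admissible a K C L -> t <> 0 -> 0 < vel a L t.
Proof.
intros HA Ht; rewrite vel_neq0 by auto.
apply (adot_pos _ _ _ _ _ HA), Rabs_pos_lt; auto.
Qed.

Lemma vel_opp (a : R -> R) (L t : R) : vel a L (- t) = vel a L t.
Proof.
unfold vel; destruct (Req_dec_T (- t) 0), (Req_dec_T t 0); try lra; now rewrite Rabs_Ropp.
Qed.

Lemma locally_neq (x y : R) : x <> y -> locally x (fun u => u <> y).
Proof. apply (open_neq y). Qed.

Lemma continuity_pt_ext_locally (f g : R -> R) (x : R) :
  locally x (fun t => f t = g t) -> continuity_pt f x -> continuity_pt g x.
Proof.
intros H Hf; apply continuity_pt_filterlim in Hf; apply continuity_pt_filterlim.
apply (continuous_ext_loc g f); auto.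
Qed.

Lemma continuity_pt_Rabs (x : R) : continuity_pt Rabs x.
Proof. apply continuity_pt_filterlim, continuous_Rabs. Qed.

Lemma vel_continuous (a : R -> R) (K C L t : R) :
  admissible a K C L -> continuity_pt (vel a L) t.
Proof.
intros HA; destruct (Req_dec t 0) as [->|N].
- intros eps He; destruct (at_right_eps _ _ _ _ (ad_limit _ _ _ _ HA) He) as [d [Hd H]].
  exists d; split; auto; intros x [[_ Hx] Hx2]; simpl in *; unfold Rdist in *.
  rewrite Rminus_0_r in Hx2; rewrite vel_neq0 by auto.
  unfold vel at 1; destruct (Req_dec_T 0 0); [|lra].
  apply H; assert (0 < Rabs x) by (apply Rabs_pos_lt; auto); lra.
- apply continuity_pt_ext_locally with (fun t => adot a (Rabs t)).
  + apply filter_imp with (2 := locally_neq t 0 N); intros u Hu; now rewrite vel_neq0.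
  + apply (continuity_pt_comp Rabs (adot a)); [apply continuity_pt_Rabs|].
    eapply is_derive_continuity_pt, (is_derive_adot _ _ _ _ _ HA), Rabs_pos_lt; auto.
Qed.

Lemma is_derive_aodd (a : R -> R) (K C L t : R) :
  admissible a K C L -> is_derive (aodd a) t (vel a L t).
Proof.
intros HA.
assert (D : forall t, t <> 0 -> is_derive (aodd a) t (vel a L t)).
{ clear t; intros t Ht; rewrite vel_neq0 by auto.
  destruct (Rtotal_order t 0) as [H|[H|H]]; [| lra |].
  - rewrite Rabs_left by auto.
    apply is_derive_ext_loc with (fun t => - a (- t)).
    + apply filter_imp with (2 := open_lt 0 t H); intros u Hu.
      unfold aodd; destruct (Rle_dec 0 u); auto; lra.
    + assert (D := is_derive_a _ _ _ _ (- t) HA ltac:(lra)).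
      auto_derive; [eexists; exact D|].
      replace (Derive (fun x => a x) (- t)) with (adot a (- t))
        by (symmetry; apply is_derive_unique; exact D).
      ring.
  - rewrite Rabs_pos_eq by lra.
    apply is_derive_ext_loc with a; [|apply (is_derive_a _ _ _ _ _ HA); auto].
    apply filter_imp with (2 := open_gt 0 t H); intros u Hu.
    rewrite aodd_nonneg; auto; lra. }
destruct (Req_dec t 0) as [->|N]; auto.
apply (is_derive_extend (aodd a) (vel a L) 0 1); [lra| |auto|eapply vel_continuous; eauto].
intros eps He.
destruct (ad_regular _ _ _ _ HA) as [[_ [_ [Hc _]]] _].
destruct (Hc 0 (Rle_refl 0) (fun y => Rabs (y - a 0) < eps)) as [d Hd].
{ exists (mkposreal _ He); intros y Hy; exact Hy. }
exists d; split; [apply cond_pos|]; intros x [_ Hx]; simpl in *; unfold Rdist in *.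
rewrite (aodd_nonneg a 0), (a_0 _ _ _ _ HA), Rminus_0_r by lra.
rewrite Rminus_0_r in Hx; rewrite (Rabs_aodd _ _ _ _ _ HA).
specialize (Hd (Rabs x)); rewrite (a_0 _ _ _ _ HA), Rminus_0_r in Hd.
apply Rle_lt_trans with (1 := Rle_abs _); apply Hd; [|apply Rabs_pos].
change (Rabs (Rabs x - 0) < d); now rewrite Rminus_0_r, Rabs_Rabsolu.
Qed.

Lemma aodd_continuous (a : R -> R) (K C L t : R) :
  admissible a K C L -> continuity_pt (aodd a) t.
Proof. intros HA; eapply is_derive_continuity_pt, is_derive_aodd; eauto. Qed.

(* Since [a * addot >= - K * adot ^ 2], [a ^ n * adot] is nondecreasing for [n >= K],
   so [a ^ (n + 1)] grows at least linearly. *)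
Lemma a_unbounded (a : R -> R) (K C L y : R) :
  admissible a K C L -> exists t, 0 < t /\ y < a t.
Proof.
intros HA; destruct (ad_regular _ _ _ _ HA) as [_ [HK1 HK]].
destruct (INR_unbounded K) as [m Hm].
assert (HmS : K <= INR (S m)) by (rewrite S_INR; lra).
set (E t := a t ^ S m * adot a t).
assert (DE : forall t, 0 < t ->
   is_derive E t (a t ^ m * (INR (S m) * adot a t ^ 2 + a t * addot a t))).
{ intros t Ht; unfold E.
  assert (D1 := is_derive_a _ _ _ _ t HA Ht); assert (D2 := is_derive_adot _ _ _ _ t HA Ht).
  auto_derive; [split; [eexists; exact D1|split; [eexists; exact D2|exact I]]|].
  replace (Derive (fun x => a x) t) with (adot a t)
    by (symmetry; apply is_derive_unique; exact D1).
  replace (Derive (fun x => adot a x) t) with (addot a t)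
    by (symmetry; apply is_derive_unique; exact D2).
  change (match m with 0%nat => 1 | S _ => INR m + 1 end) with (INR (S m)).
  ring. }
assert (PE : forall t, 0 < t -> 0 <= a t ^ m * (INR (S m) * adot a t ^ 2 + a t * addot a t)).
{ intros t Ht; assert (Ha := a_pos _ _ _ _ t HA Ht); assert (Hd := adot_pos _ _ _ _ t HA Ht).
  apply Rmult_le_pos; [apply pow_le; lra|].
  assert (H2 : 0 < adot a t ^ 2) by (apply pow_lt; auto).
  specialize (HK t Ht).
  assert (- K * adot a t ^ 2 <= a t * addot a t).
  { apply Rle_div_r in HK; auto. }
  assert (K * adot a t ^ 2 <= INR (S m) * adot a t ^ 2) by (apply Rmult_le_compat_r; lra).
  lra. }
assert (HE : forall t, 1 <= t -> E 1 <= E t).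
{ intros t Ht.
  apply (derive_nonneg_le E (fun t => a t ^ m * (INR (S m) * adot a t ^ 2 + a t * addot a t))); auto.
  - intros u Hu; apply DE; lra.
  - intros u Hu; eapply is_derive_continuity_pt, DE; lra.
  - intros u Hu; apply PE; lra. }
assert (HE1 : 0 < E 1).
{ unfold E; apply Rmult_lt_0_compat.
  - apply pow_lt, (a_pos _ _ _ _ _ HA); lra.
  - apply (adot_pos _ _ _ _ _ HA); lra. }
assert (HF : forall t, 1 <= t -> E 1 * (t - 1) <= a t ^ S (S m)).
{ intros t Ht.
  assert (T : a 1 ^ S (S m) - E 1 * (1 - 1) <= a t ^ S (S m) - E 1 * (t - 1)).
  { assert (DF : forall u, 0 < u -> is_derive (fun t => a t ^ S (S m) - E 1 * (t - 1)) u
        (INR (S (S m)) * E u - E 1)).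
    { intros u Hu; unfold E at 2; assert (D1 := is_derive_a _ _ _ _ u HA Hu).
      auto_derive; [eexists; exact D1|].
      replace (Derive (fun x => a x) u) with (adot a u)
        by (symmetry; apply is_derive_unique; exact D1).
      change (match m with 0%nat => 1 | S _ => INR m + 1 end + 1) with (INR (S (S m))).
      change (a u ^ S m) with (a u * a u ^ m); ring. }
    apply (derive_nonneg_le (fun t => a t ^ S (S m) - E 1 * (t - 1))
      (fun u => INR (S (S m)) * E u - E 1)); auto.
    - intros u Hu; apply DF; lra.
    - intros u Hu; eapply is_derive_continuity_pt, DF; lra.
    - intros u Hu; assert (H1 := HE u ltac:(lra)).
      assert (H2 : 0 <= INR (S m) * E u) by (apply Rmult_le_pos; [apply pos_INR|lra]).
      rewrite S_INR; lra. }
  assert (0 < a 1 ^ S (S m)) by (apply pow_lt, (a_pos _ _ _ _ _ HA); lra).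
  lra. }
set (z := Rabs y).
assert (Hz0 : 0 <= z ^ S (S m)) by (apply pow_le, Rabs_pos).
(* At this time the linear lower bound on [a t ^ S (S m)] equals [E 1 + z ^ S (S m)], with
   [E 1 > 0]. *)
exists (2 + z ^ S (S m) / E 1).
assert (Hq : 0 <= z ^ S (S m) / E 1) by (apply Rdiv_le_0_compat; auto).
split; [lra|].
assert (H := HF (2 + z ^ S (S m) / E 1) ltac:(lra)).
replace (E 1 * (2 + z ^ S (S m) / E 1 - 1)) with (E 1 + z ^ S (S m)) in H by (field; lra).
apply Rle_lt_trans with z; [apply Rle_abs|].
destruct (Rlt_dec z (a (2 + z ^ S (S m) / E 1))) as [Hlt|Hge]; auto.
assert (Ha := a_pos _ _ _ _ (2 + z ^ S (S m) / E 1) HA ltac:(lra)).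
assert (a (2 + z ^ S (S m) / E 1) ^ S (S m) <= z ^ S (S m)) by (apply pow_incr; lra).
lra.
Qed.

(** * The inverse of the odd extension *)

Lemma aodd_ainv (a : R -> R) (K C L s : R) : admissible a K C L -> aodd a (ainv a s) = s.
Proof.
intros HA; unfold ainv; apply epsilon_spec.
destruct (a_unbounded _ _ _ _ (Rabs s) HA) as [T [HT Hs]].
destruct (IVT_gen (aodd a) (- T) T s) as [t [_ Ht]]; [|rewrite (aodd_opp _ _ _ _ _ HA)|].
- intro; eapply aodd_continuous; eauto.
- rewrite aodd_nonneg by lra; assert (Ha := a_pos _ _ _ _ T HA HT).
  rewrite Rmin_left, Rmax_right by lra.
  revert Hs; unfold Rabs; destruct Rcase_abs; lra.
- now exists t.
Qed.

Lemma aodd_inj (a : R -> R) (K C L s t : R) :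
  admissible a K C L -> aodd a s = aodd a t -> s = t.
Proof.
intros HA E; destruct (Rtotal_order s t) as [H|[H|H]]; auto;
  apply (aodd_incr _ _ _ _ _ _ HA) in H; lra.
Qed.

Lemma ainv_aodd (a : R -> R) (K C L t : R) : admissible a K C L -> ainv a (aodd a t) = t.
Proof. intros HA; apply (aodd_inj _ _ _ _ _ _ HA), (aodd_ainv _ _ _ _ _ HA). Qed.

Lemma ainv_opp (a : R -> R) (K C L s : R) : admissible a K C L -> ainv a (- s) = - ainv a s.
Proof.
intros HA; apply (aodd_inj _ _ _ _ _ _ HA).
now rewrite (aodd_opp _ _ _ _ _ HA), !(aodd_ainv _ _ _ _ _ HA).
Qed.

Lemma ainv_0 (a : R -> R) (K C L : R) : admissible a K C L -> ainv a 0 = 0.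
Proof.
intros HA; rewrite <- (ainv_aodd _ _ _ _ 0 HA) at 2; f_equal.
rewrite aodd_nonneg by lra; symmetry; apply (a_0 _ _ _ _ HA).
Qed.

Lemma ainv_lt (a : R -> R) (K C L s t : R) :
  admissible a K C L -> (ainv a s < t <-> s < aodd a t).
Proof.
intros HA; split; intros H.
- rewrite <- (aodd_ainv _ _ _ _ s HA); apply (aodd_incr _ _ _ _ _ _ HA); auto.
- destruct (Rlt_dec (ainv a s) t) as [|N]; auto; exfalso.
  rewrite <- (aodd_ainv _ _ _ _ s HA) in H.
  destruct (Rle_lt_or_eq_dec t (ainv a s)) as [H1|H1]; [lra| |rewrite <- H1 in H; lra].
  apply (aodd_incr _ _ _ _ _ _ HA) in H1; lra.
Qed.

Lemma ainv_gt (a : R -> R) (K C L s t : R) :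
  admissible a K C L -> (t < ainv a s <-> aodd a t < s).
Proof.
intros HA; assert (H := ainv_lt _ _ _ _ (- s) (- t) HA).
rewrite (ainv_opp _ _ _ _ _ HA), (aodd_opp _ _ _ _ _ HA) in H; split; intros; lra.
Qed.

Lemma ainv_continuous (a : R -> R) (K C L s : R) :
  admissible a K C L -> continuity_pt (ainv a) s.
Proof.
intros HA eps He; set (t := ainv a s).
assert (H1 : aodd a (t - eps) < s) by (apply (ainv_gt _ _ _ _ _ _ HA); unfold t; lra).
assert (H2 : s < aodd a (t + eps)) by (apply (ainv_lt _ _ _ _ _ _ HA); unfold t; lra).
exists (Rmin (s - aodd a (t - eps)) (aodd a (t + eps) - s)); split.
- apply Rmin_pos; lra.
- intros x [_ Hx]; simpl in *; unfold Rdist in *; fold t.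
  assert (L1 := Rmin_l (s - aodd a (t - eps)) (aodd a (t + eps) - s)).
  assert (L2 := Rmin_r (s - aodd a (t - eps)) (aodd a (t + eps) - s)).
  assert (Hx2 : Rabs (x - s) < s - aodd a (t - eps)) by lra.
  assert (Hx3 : Rabs (x - s) < aodd a (t + eps) - s) by lra.
  apply Rabs_def2 in Hx2; apply Rabs_def2 in Hx3.
  assert (t - eps < ainv a x) by (apply (ainv_gt _ _ _ _ _ _ HA); lra).
  assert (ainv a x < t + eps) by (apply (ainv_lt _ _ _ _ _ _ HA); lra).
  apply Rabs_def1; lra.
Qed.

Lemma ainv_pos (a : R -> R) (K C L s : R) : admissible a K C L -> 0 < s -> 0 < ainv a s.
Proof.
intros HA Hs; apply (ainv_gt _ _ _ _ _ _ HA).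
rewrite aodd_nonneg, (a_0 _ _ _ _ HA) by lra; auto.
Qed.

Lemma is_derive_ainv (a : R -> R) (K C L s : R) :
  admissible a K C L -> 0 < s -> is_derive (ainv a) s (/ vel a L (ainv a s)).
Proof.
intros HA Hs; set (t := ainv a s).
assert (Ht : 0 < t) by (apply (ainv_pos _ _ _ _ _ HA); auto).
set (v := vel a L t); assert (Hv : 0 < v) by (apply (vel_pos _ _ _ _ _ HA); lra).
apply is_derive_Reals; intros eps He.
(* [e <= v / 2] allows [e * Rabs k] to be absorbed, giving [Rabs k <= 2 * Rabs h / v]; the second
   bound then turns the error into [eps / 2]. *)
set (e := Rmin (v / 2) (eps * v ^ 2 / 4)).
assert (Hv2 : 0 < eps * v ^ 2) by (apply Rmult_lt_0_compat; auto; apply pow_lt; auto).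
assert (He0 : 0 < e) by (apply Rmin_pos; lra).
assert (He1 : e <= v / 2) by apply Rmin_l.
assert (He2 : e <= eps * v ^ 2 / 4) by apply Rmin_r.
destruct (is_derive_eps _ _ _ e (is_derive_aodd _ _ _ _ t HA) He0) as [d [Hd H]].
fold v in H.
destruct (ainv_continuous _ _ _ _ s HA d Hd) as [d' [Hd' Hc]].
exists (mkposreal _ Hd'); simpl; intros h Hh0 Hh.
set (t' := ainv a (s + h)); fold t in Hc.
assert (Hdt : Rabs (t' - t) < d).
{ apply (Hc (s + h)); split; [split; [exact I|lra]|].
  simpl; unfold Rdist; now replace (s + h - s) with h by ring. }
specialize (H t' Hdt).
replace (aodd a t') with (s + h) in H by (symmetry; apply (aodd_ainv _ _ _ _ _ HA)).
replace (aodd a t) with s in H by (symmetry; apply (aodd_ainv _ _ _ _ _ HA)).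
replace (s + h - s) with h in H by ring.
set (k := t' - t) in *.
assert (Hk : Rabs k <= 2 * Rabs h / v).
{ apply Rle_div_r; auto.
  assert (T := Rabs_triang (h - v * k) (- h)).
  replace (h - v * k + - h) with (- (v * k)) in T by ring.
  rewrite !Rabs_Ropp, Rabs_mult, (Rabs_pos_eq v) in T by lra.
  assert (e * Rabs k <= v / 2 * Rabs k) by (apply Rmult_le_compat_r; [apply Rabs_pos|lra]).
  lra. }
change (Rabs (k / h - / v) < eps).
replace (k / h - / v) with (- (h - v * k) / (v * h)) by (field; lra).
assert (Hh1 : 0 < Rabs h) by (apply Rabs_pos_lt; auto).
rewrite Rabs_div by (apply Rmult_integral_contrapositive_currified; lra).
rewrite Rabs_Ropp, Rabs_mult, (Rabs_pos_eq v) by lra.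
apply Rle_lt_trans with (eps / 2); [|lra].
apply Rle_div_l; [apply Rmult_lt_0_compat; auto|].
apply Rle_trans with (1 := H).
apply Rle_trans with (eps * v ^ 2 / 4 * (2 * Rabs h / v)).
- apply Rmult_le_compat; auto; [lra|apply Rabs_pos].
- right; field; lra.
Qed.

(** * The Hubble radius, its logarithmic derivative, and their Lipschitz bounds *)

Lemma continuity_pt_decel (a : R -> R) (K C L t : R) :
  admissible a K C L -> 0 < t -> continuity_pt (decel a) t.
Proof.
intros HA Ht; unfold decel.
assert (Hd := adot_pos _ _ _ _ t HA Ht).
assert (C1 := is_derive_continuity_pt _ _ _ (is_derive_adot _ _ _ _ t HA Ht)).
apply (continuity_pt_div (fun t => a t * addot a t) (fun t => adot a t ^ 2)).
- apply continuity_pt_mult; eapply is_derive_continuity_pt;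
    [eapply is_derive_a|eapply is_derive_addot]; eauto.
- apply (continuity_pt_comp (adot a) (fun x => x ^ 2)); auto; apply continuity_pt_pow2.
- apply Rgt_not_eq, pow_lt; auto.
Qed.

Lemma decel_bounds (a : R -> R) (K C L t : R) :
  admissible a K C L -> 0 < t -> 1 <= K /\ - K <= decel a t <= 1.
Proof.
intros HA Ht; destruct (ad_regular _ _ _ _ HA) as [[_ [_ [_ [_ [_ H1]]]]] [HK H2]].
split; auto; split; [apply H2|apply H1]; auto.
Qed.

Lemma hub_pos_eq (a : R -> R) (K C L t : R) :
  admissible a K C L -> 0 < t -> hub a L t = a t / adot a t.
Proof.
intros HA Ht; unfold hub; rewrite (Rabs_aodd _ _ _ _ _ HA), vel_neq0, Rabs_pos_eq by lra; auto.
Qed.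

Lemma hub_0 (a : R -> R) (K C L : R) : admissible a K C L -> hub a L 0 = 0.
Proof.
intros HA; unfold hub; rewrite (Rabs_aodd _ _ _ _ _ HA), Rabs_R0, (a_0 _ _ _ _ HA).
unfold Rdiv; ring.
Qed.

Lemma hub_opp (a : R -> R) (K C L t : R) : admissible a K C L -> hub a L (- t) = hub a L t.
Proof.
intros HA; unfold hub; now rewrite vel_opp, !(Rabs_aodd _ _ _ _ _ HA), Rabs_Ropp.
Qed.

Lemma hub_abs (a : R -> R) (K C L t : R) : admissible a K C L -> hub a L (Rabs t) = hub a L t.
Proof.
intros HA; unfold Rabs; destruct Rcase_abs; auto; apply (hub_opp _ _ _ _ _ HA).
Qed.

Lemma hub_pos (a : R -> R) (K C L t : R) : admissible a K C L -> 0 < t -> 0 < hub a L t.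
Proof.
intros HA Ht; rewrite (hub_pos_eq _ _ _ _ _ HA Ht).
apply Rdiv_lt_0_compat; [apply (a_pos _ _ _ _ _ HA)|apply (adot_pos _ _ _ _ _ HA)]; auto.
Qed.

Lemma hub_small (a : R -> R) (K C L eps : R) :
  admissible a K C L -> 0 < eps ->
  exists d, 0 < d /\ forall t, Rabs t < d -> 0 <= hub a L t < eps.
Proof.
intros HA He; destruct (at_right_eps _ _ _ _ (ad_hub _ _ _ _ HA) He) as [d [Hd H]].
exists d; split; auto; intros t Ht.
destruct (Req_dec t 0) as [->|N]; [rewrite (hub_0 _ _ _ _ HA); lra|].
assert (Hp : 0 < Rabs t) by (apply Rabs_pos_lt; auto).
rewrite <- (hub_abs _ _ _ _ _ HA).
split; [apply Rlt_le, (hub_pos _ _ _ _ _ HA); auto|].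
rewrite (hub_pos_eq _ _ _ _ _ HA) by auto.
specialize (H (Rabs t) ltac:(lra)); rewrite Rminus_0_r in H.
apply Rle_lt_trans with (2 := H), Rle_abs.
Qed.

Lemma hub_continuous (a : R -> R) (K C L t : R) :
  admissible a K C L -> continuity_pt (hub a L) t.
Proof.
intros HA; destruct (Req_dec t 0) as [->|N].
- intros eps He; destruct (hub_small _ _ _ _ eps HA He) as [d [Hd H]].
  exists d; split; auto; intros x [_ Hx]; simpl in *; unfold Rdist in *.
  rewrite (hub_0 _ _ _ _ HA), Rminus_0_r; rewrite Rminus_0_r in Hx.
  rewrite Rabs_pos_eq; apply H; auto.
- apply (continuity_pt_div (fun t => Rabs (aodd a t)) (vel a L)).
  + apply (continuity_pt_comp (aodd a) Rabs); [eapply aodd_continuous; eauto|].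
    apply continuity_pt_Rabs.
  + eapply vel_continuous; eauto.
  + apply Rgt_not_eq, (vel_pos _ _ _ _ _ HA); auto.
Qed.

Lemma hubl_0 (a : R -> R) (K C L : R) : admissible a K C L -> hubl a L 0 = 0.
Proof. intros HA; unfold hubl; rewrite (hub_0 _ _ _ _ HA); ring. Qed.

(** [decel] need not have a limit at 0. Strong regularity bounds [1 - decel] by [1 + K], and [hub]
    tends to 0, so the product does too. *)
Lemma hubl_continuous (a : R -> R) (K C L t : R) :
  admissible a K C L -> continuity_pt (hubl a L) t.
Proof.
intros HA; destruct (Req_dec t 0) as [->|N].
- intros eps He.
  destruct (decel_bounds _ _ _ _ 1 HA Rlt_0_1) as [HK _].
  assert (He2 : 0 < eps / (1 + K)) by (apply Rdiv_lt_0_compat; lra).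
  destruct (hub_small _ _ _ _ (eps / (1 + K)) HA He2) as [d [Hd H]].
  exists d; split; auto; intros x [[_ Hx0] Hx]; simpl in *; unfold Rdist in *.
  rewrite (hubl_0 _ _ _ _ HA), Rminus_0_r; rewrite Rminus_0_r in Hx.
  specialize (H x Hx); unfold hubl.
  destruct (decel_bounds _ _ _ _ (Rabs x) HA) as [_ B]; [apply Rabs_pos_lt; auto|].
  rewrite Rabs_pos_eq by (apply Rmult_le_pos; lra).
  apply Rle_lt_trans with (hub a L x * (1 + K)); [apply Rmult_le_compat_l; lra|].
  apply Rlt_le_trans with (eps / (1 + K) * (1 + K)); [apply Rmult_lt_compat_r; lra|].
  right; field; lra.
- apply (continuity_pt_mult (hub a L) (fun t => 1 - decel a (Rabs t))).
  + eapply hub_continuous; eauto.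
  + apply (continuity_pt_minus (fun _ => 1) (fun t => decel a (Rabs t))).
    * apply continuity_pt_const; intro; auto.
    * apply (continuity_pt_comp Rabs (decel a)); [apply continuity_pt_Rabs|].
      eapply continuity_pt_decel; eauto; apply Rabs_pos_lt; auto.
Qed.

Lemma is_derive_hub (a : R -> R) (K C L t : R) :
  admissible a K C L -> 0 < t -> is_derive (hub a L) t (1 - decel a t).
Proof.
intros HA Ht.
apply is_derive_ext_loc with (fun t => a t / adot a t).
{ apply filter_imp with (2 := open_gt 0 t Ht); intros u Hu.
  rewrite (hub_pos_eq _ _ _ _ _ HA); auto. }
assert (D1 := is_derive_a _ _ _ _ t HA Ht); assert (D2 := is_derive_adot _ _ _ _ t HA Ht).
assert (Hd := adot_pos _ _ _ _ t HA Ht).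
replace (1 - decel a t) with ((adot a t * adot a t - a t * addot a t) / adot a t ^ 2)
  by (unfold decel; field; lra).
apply (is_derive_div a (adot a)); auto; lra.
Qed.

(** The product rule for [hub * (1 - decel)], expanded so that only [decel] and the dimensionless
    third-derivative term occur, both of which are bounded by hypothesis. *)
Definition hubl' (a : R -> R) (t : R) : R :=
  (1 - decel a t) ^ 2 - decel a t - adddot a t * a t ^ 2 / adot a t ^ 3 + 2 * decel a t ^ 2.

Lemma is_derive_hubl (a : R -> R) (K C L t : R) :
  admissible a K C L -> 0 < t -> is_derive (hubl a L) t (hubl' a t).
Proof.
intros HA Ht.
assert (D1 := is_derive_a _ _ _ _ t HA Ht); assert (D2 := is_derive_adot _ _ _ _ t HA Ht).
assert (D3 := is_derive_addot _ _ _ _ t HA Ht).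
assert (Hd := adot_pos _ _ _ _ t HA Ht).
assert (Ha := a_pos _ _ _ _ t HA Ht).
apply is_derive_ext_loc with
  (fun t => a t / adot a t * (1 - a t * addot a t / adot a t ^ 2)).
{ apply filter_imp with (2 := open_gt 0 t Ht); intros u Hu.
  unfold hubl; rewrite (hub_pos_eq _ _ _ _ _ HA), Rabs_pos_eq; auto; lra. }
auto_derive.
- repeat split; try (eexists; eassumption); try lra.
  apply Rgt_not_eq; repeat apply Rmult_lt_0_compat; lra.
- replace (Derive (fun x => a x) t) with (adot a t)
    by (symmetry; apply is_derive_unique; exact D1).
  replace (Derive (fun x => adot a x) t) with (addot a t)
    by (symmetry; apply is_derive_unique; exact D2).
  replace (Derive (fun x => addot a x) t) with (adddot a t)
    by (symmetry; apply is_derive_unique; exact D3).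
  unfold hubl', decel; field; lra.
Qed.

Lemma hubl'_bound (a : R -> R) (K C L t : R) :
  admissible a K C L -> 0 < t -> Rabs (hubl' a t) <= (1 + K) ^ 2 + K + C + 2 * K ^ 2.
Proof.
intros HA Ht; destruct (decel_bounds _ _ _ _ t HA Ht) as [HK B].
destruct (ad_third _ _ _ _ HA t Ht) as [_ HC]; apply Rabs_le_between in HC.
unfold hubl'; set (q := decel a t) in *; set (c := adddot a t * a t ^ 2 / adot a t ^ 3) in *.
(* Since [q <= 1 <= K], the constant [K] bounds [q] in absolute value. *)
assert (0 <= q ^ 2 <= K ^ 2) by nra.
assert (0 <= (1 - q) ^ 2 <= (1 + K) ^ 2) by nra.
apply Rabs_le; split; lra.
Qed.

(** The derivative in [s] is the bounded time derivative [dg] divided by [vel]. The factor [/ vel]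
    is continuous, hence bounded, near [A > 0], but it may blow up at 0, so the Lipschitz property
    is local. *)
Lemma lipschitz_near_ainv (a g dg : R -> R) (K C L M A : R) :
  admissible a K C L -> (forall t, 0 < t -> is_derive g t (dg t)) ->
  (forall t, 0 < t -> Rabs (dg t) <= M) -> 0 < A ->
  lipschitz_near (fun s => g (ainv a s)) A.
Proof.
intros HA Hg HM HA0.
set (w s := / vel a L (ainv a s)).
assert (Cw : continuity_pt w A).
{ apply (continuity_pt_inv (fun s => vel a L (ainv a s))).
  - apply (continuity_pt_comp (ainv a) (vel a L)).
    + eapply ainv_continuous; eauto.
    + eapply vel_continuous; eauto.
  - apply Rgt_not_eq, (vel_pos _ _ _ _ _ HA), Rgt_not_eq, (ainv_pos _ _ _ _ _ HA); auto. }
destruct (Cw 1 Rlt_0_1) as [d1 [Hd1 H1]].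
assert (HM0 : 0 <= M).
{ apply Rle_trans with (2 := HM 1 Rlt_0_1), Rabs_pos. }
exists (Rmin d1 A), (M * (Rabs (w A) + 1)); split; [apply Rmin_pos; auto|split].
{ apply Rmult_le_pos; auto; generalize (Rabs_pos (w A)); lra. }
assert (L1 := Rmin_l d1 A); assert (L2 := Rmin_r d1 A).
intros s t Hs Ht.
assert (Bt : forall u, Rmin t s <= u <= Rmax t s -> Rabs (u - A) < Rmin d1 A).
{ intros u; unfold Rmin at 1, Rmax; destruct (Rle_dec t s); intros Hu;
  revert Hs Ht; unfold Rabs; repeat destruct Rcase_abs; lra. }
assert (Bp : forall u, Rabs (u - A) < Rmin d1 A -> 0 < u).
{ intros u Hu; assert (Hu2 : Rabs (u - A) < A) by lra; apply Rabs_def2 in Hu2; lra. }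
assert (D : forall u, 0 < u ->
   is_derive (fun s => g (ainv a s)) u (dg (ainv a u) * w u)).
{ intros u Hu; rewrite Rmult_comm.
  apply (is_derive_comp g (ainv a)).
  - apply Hg, (ainv_pos _ _ _ _ _ HA); auto.
  - apply (is_derive_ainv _ _ _ _ _ HA); auto. }
destruct (MVT_gen (fun s => g (ainv a s)) t s (fun u => dg (ainv a u) * w u)) as [c [Hc E]].
- intros u Hu; apply D, Bp, Bt; lra.
- intros u Hu; eapply is_derive_continuity_pt, D, Bp, Bt; auto.
- rewrite E, !Rabs_mult; apply Rmult_le_compat_r; [apply Rabs_pos|].
  apply Rmult_le_compat; try apply Rabs_pos.
  + apply HM, (ainv_pos _ _ _ _ _ HA), Bp, Bt; auto.
  + destruct (Req_dec c A) as [->|N]; [lra|].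
    assert (H2 : Rabs (w c - w A) < 1).
    { apply (H1 c); split; [split; [exact I|auto]|].
      simpl; unfold Rdist; specialize (Bt c Hc); lra. }
    assert (T := Rabs_triang_inv (w c) (w A)); lra.
Qed.

Lemma admissible_profile (a : R -> R) (K C L : R) :
  admissible a K C L ->
  hubble_profile (fun s => hub a L (ainv a s)) (fun s => hubl a L (ainv a s))
    (fun s => vel a L (ainv a s)).
Proof.
intros HA; assert (Hc := fun s => ainv_continuous _ _ _ _ s HA).
split.
- intros s; apply (continuity_pt_comp (ainv a)); auto; eapply hub_continuous; eauto.
- intros s; apply (continuity_pt_comp (ainv a)); auto; eapply hubl_continuous; eauto.
- intros s; apply (continuity_pt_comp (ainv a)); auto; eapply vel_continuous; eauto.
- intros s; now rewrite (ainv_opp _ _ _ _ _ HA), (hub_opp _ _ _ _ _ HA).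
- intros s; unfold hubl; now rewrite (ainv_opp _ _ _ _ _ HA), (hub_opp _ _ _ _ _ HA), Rabs_Ropp.
- intros s; now rewrite (ainv_opp _ _ _ _ _ HA), vel_opp.
- now rewrite (ainv_0 _ _ _ _ HA), (hub_0 _ _ _ _ HA).
- now rewrite (ainv_0 _ _ _ _ HA), (hubl_0 _ _ _ _ HA).
- intros s Hs; apply (hub_pos _ _ _ _ _ HA), (ainv_pos _ _ _ _ _ HA); auto.
- intros s Hs; unfold hub; rewrite (aodd_ainv _ _ _ _ _ HA), Rabs_pos_eq by lra.
  field; apply Rgt_not_eq, (vel_pos _ _ _ _ _ HA), Rgt_not_eq, (ainv_pos _ _ _ _ _ HA); auto.
- intros s Hs; assert (Ht := ainv_pos _ _ _ _ s HA Hs).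
  assert (Hv := vel_pos _ _ _ _ (ainv a s) HA (Rgt_not_eq _ _ Ht)).
  replace (hubl a L (ainv a s) / s)
    with (scal (/ vel a L (ainv a s)) (1 - decel a (ainv a s))).
  + apply (is_derive_comp (hub a L) (ainv a)).
    * apply (is_derive_hub _ _ _ _ _ HA); auto.
    * apply (is_derive_ainv _ _ _ _ _ HA); auto.
  + unfold hubl, hub; rewrite (aodd_ainv _ _ _ _ _ HA), !Rabs_pos_eq by lra.
    unfold scal; simpl; unfold mult; simpl; field; lra.
- intros s Hs; apply (lipschitz_near_ainv a (hub a L) (fun t => 1 - decel a t) K C L (1 + K)); auto.
  + intros t; apply (is_derive_hub _ _ _ _ _ HA).
  + intros t Ht; destruct (decel_bounds _ _ _ _ t HA Ht) as [HK B]; apply Rabs_le; lra.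
- intros s Hs; apply (lipschitz_near_ainv a (hubl a L) (hubl' a) K C L
    ((1 + K) ^ 2 + K + C + 2 * K ^ 2)); auto.
  + intros t; apply (is_derive_hubl _ _ _ _ _ HA).
  + intros t; apply (hubl'_bound _ _ _ _ _ HA).
Qed.

(** * The integrals of the theorem in the angle variable *)

Definition angle (a : R -> R) (tau t : R) : R := asin (aodd a t / a tau).

Definition hubS (a : R -> R) (L s : R) : R := hub a L (ainv a s).
Definition hublS (a : R -> R) (L s : R) : R := hubl a L (ainv a s).
Definition velS (a : R -> R) (L s : R) : R := vel a L (ainv a s).

Lemma hubS_aodd (a : R -> R) (K C L t : R) :
  admissible a K C L -> hubS a L (aodd a t) = hub a L t.
Proof. intros HA; unfold hubS; now rewrite (ainv_aodd _ _ _ _ _ HA). Qed.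

Lemma ratio_bound (a : R -> R) (K C L tau t : R) :
  admissible a K C L -> - tau < t < tau -> -1 < aodd a t / a tau < 1.
Proof.
intros HA Ht; assert (Hp := a_pos _ _ _ _ tau HA ltac:(lra)).
assert (H1 := aodd_incr _ _ _ _ _ _ HA (proj1 Ht)).
assert (H2 := aodd_incr _ _ _ _ _ _ HA (proj2 Ht)).
rewrite (aodd_opp _ _ _ _ _ HA), aodd_nonneg in H1 by lra.
rewrite (aodd_nonneg a tau) in H2 by lra.
split; [apply Rlt_div_r|apply Rlt_div_l]; lra.
Qed.

Lemma angle_bound (a : R -> R) (K C L tau t : R) :
  admissible a K C L -> - tau < t < tau -> - (PI / 2) < angle a tau t < PI / 2.
Proof. intros HA Ht; apply asin_bound_lt, (ratio_bound _ _ _ _ _ _ HA); auto. Qed.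

Lemma sin_angle (a : R -> R) (K C L tau t : R) :
  admissible a K C L -> - tau < t < tau -> a tau * sin (angle a tau t) = aodd a t.
Proof.
intros HA Ht; assert (B := ratio_bound _ _ _ _ _ _ HA Ht).
assert (Hp := a_pos _ _ _ _ tau HA ltac:(lra)).
unfold angle; rewrite sin_asin by lra; field; lra.
Qed.

Definition gap (a : R -> R) (tau t : R) : R := sqrt (a tau ^ 2 - aodd a t ^ 2).

Lemma gap_arg_pos (a : R -> R) (K C L tau t : R) :
  admissible a K C L -> - tau < t < tau -> 0 < a tau ^ 2 - aodd a t ^ 2.
Proof.
intros HA Ht; assert (B := ratio_bound _ _ _ _ _ _ HA Ht).
assert (Hp := a_pos _ _ _ _ tau HA ltac:(lra)).
set (x := aodd a t / a tau) in *.
replace (aodd a t) with (x * a tau) by (unfold x; field; lra).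
replace (a tau ^ 2 - (x * a tau) ^ 2) with (a tau * a tau * ((1 - x) * (1 + x))) by ring.
repeat apply Rmult_lt_0_compat; lra.
Qed.

Lemma gap_pos (a : R -> R) (K C L tau t : R) :
  admissible a K C L -> - tau < t < tau -> 0 < gap a tau t.
Proof. intros HA Ht; apply sqrt_lt_R0, (gap_arg_pos _ _ _ _ _ _ HA); auto. Qed.

Lemma cos_angle (a : R -> R) (K C L tau t : R) :
  admissible a K C L -> - tau < t < tau -> cos (angle a tau t) = gap a tau t / a tau.
Proof.
intros HA Ht; assert (B := ratio_bound _ _ _ _ _ _ HA Ht).
assert (Hp := a_pos _ _ _ _ tau HA ltac:(lra)).
assert (Hg := gap_arg_pos _ _ _ _ _ _ HA Ht).
unfold angle, gap; rewrite cos_asin by lra.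
replace (1 - (aodd a t / a tau)²) with ((a tau ^ 2 - aodd a t ^ 2) / a tau ^ 2)
  by (unfold Rsqr; field; lra).
rewrite sqrt_div by (try apply pow_lt; lra).
rewrite <- Rsqr_pow2, sqrt_Rsqr; lra.
Qed.

Lemma is_derive_angle (a : R -> R) (K C L tau t : R) :
  admissible a K C L -> - tau < t < tau ->
  is_derive (angle a tau) t (vel a L t / gap a tau t).
Proof.
intros HA Ht; assert (B := ratio_bound _ _ _ _ _ _ HA Ht).
assert (Hp := a_pos _ _ _ _ tau HA ltac:(lra)).
assert (Hg := gap_pos _ _ _ _ _ _ HA Ht).
assert (Hc := cos_angle _ _ _ _ _ _ HA Ht).
unfold angle in Hc; rewrite cos_asin in Hc by lra.
replace (vel a L t / gap a tau t)
  with (scal (vel a L t / a tau) (1 / sqrt (1 - (aodd a t / a tau)²))).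
2:{ rewrite Hc; unfold scal; simpl; unfold mult; simpl; field; lra. }
apply (is_derive_comp asin (fun t => aodd a t / a tau)).
- apply is_derive_Reals; rewrite <- (derive_pt_asin _ B).
  apply derive_pt_eq_1 with (derivable_pt_asin _ B); reflexivity.
- replace (vel a L t / a tau) with (scal (/ a tau) (vel a L t))
    by (unfold scal; simpl; unfold mult; simpl; unfold Rdiv; ring).
  apply is_derive_ext with (fun t => scal (/ a tau) (aodd a t)).
  { intros u; unfold scal; simpl; unfold mult; simpl; unfold Rdiv; ring. }
  apply (is_derive_scal (aodd a)), (is_derive_aodd _ _ _ _ _ HA).
Qed.

Lemma angle_continuous (a : R -> R) (K C L tau t : R) :
  admissible a K C L -> - tau < t < tau -> continuity_pt (angle a tau) t.
Proof. intros HA Ht; eapply is_derive_continuity_pt, is_derive_angle; eauto. Qed.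

Lemma filterlim_at_left_eps (f : R -> R) (x l : R) :
  (forall eps, 0 < eps -> exists d, 0 < d /\ forall t, x - d < t < x -> Rabs (f t - l) < eps) ->
  filterlim f (at_left x) (locally l).
Proof.
intros H Q [e He]; destruct (H e (cond_pos e)) as [d [Hd H1]].
exists (mkposreal _ Hd); simpl; intros t Ht Htx; apply He, H1; split; auto.
change (Rabs (t - x) < d) in Ht; apply Rabs_def2 in Ht; lra.
Qed.

Lemma filterlim_at_right_of_continuity (f : R -> R) (x : R) :
  continuity_pt f x -> filterlim f (at_right x) (locally (f x)).
Proof.
intros H; apply continuity_pt_filterlim in H.
eapply filterlim_filter_le_1; [|exact H].
intros Q [d Hd]; exists d; intros y Hy _; auto.
Qed.

(** Sine is increasing, so an angle above [PI / 2 - e] amounts to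
    [aodd a t > a tau * sin (PI / 2 - e)], that is, to [t] lying beyond the inverse image of a level
    below [a tau]. *)
Lemma angle_at_left (a : R -> R) (K C L tau : R) :
  admissible a K C L -> 0 < tau ->
  filterlim (angle a tau) (at_left tau) (locally (PI / 2)).
Proof.
intros HA Htau; apply filterlim_at_left_eps; intros eps He.
assert (HP := PI_half_gt_1).
assert (Hp := a_pos _ _ _ _ tau HA Htau).
set (e := Rmin eps 1).
assert (He0 : 0 < e) by (apply Rmin_pos; lra).
assert (L1 : e <= eps) by apply Rmin_l; assert (L2 : e <= 1) by apply Rmin_r.
assert (Hc : 0 < cos (PI / 2 - e)) by (apply cos_gt_0; lra).
assert (Hs : sin (PI / 2 - e) < 1).
{ rewrite sin_shift, <- cos_0; apply cos_decreasing_1; lra. }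
assert (Hm : ainv a (a tau * sin (PI / 2 - e)) < tau).
{ apply (ainv_lt _ _ _ _ _ _ HA); rewrite aodd_nonneg by lra.
  rewrite <- (Rmult_1_r (a tau)) at 2; apply Rmult_lt_compat_l; auto. }
exists (Rmin tau (tau - ainv a (a tau * sin (PI / 2 - e)))); split; [apply Rmin_pos; lra|].
intros t Ht.
assert (M1 := Rmin_l tau (tau - ainv a (a tau * sin (PI / 2 - e)))).
assert (M2 := Rmin_r tau (tau - ainv a (a tau * sin (PI / 2 - e)))).
assert (Htt : - tau < t < tau) by lra.
assert (Ha := angle_bound _ _ _ _ _ _ HA Htt).
assert (Hsn : a tau * sin (PI / 2 - e) < aodd a t) by (apply (ainv_lt _ _ _ _ _ _ HA); lra).
rewrite <- (sin_angle _ _ _ _ _ _ HA Htt) in Hsn.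
apply Rmult_lt_reg_l in Hsn; auto.
assert (PI / 2 - e < angle a tau t) by (apply sin_increasing_0; lra).
apply Rabs_def1; lra.
Qed.

Lemma gap_continuous (a : R -> R) (K C L tau t : R) :
  admissible a K C L -> continuity_pt (gap a tau) t.
Proof.
intros HA; unfold gap; apply continuity_pt_filterlim.
apply (continuous_sqrt_comp (fun t => a tau ^ 2 - aodd a t ^ 2)).
apply continuity_pt_continuous.
apply (continuity_pt_minus (fun _ => a tau ^ 2) (fun t => aodd a t ^ 2)).
- apply continuity_pt_const; intro; auto.
- apply (continuity_pt_comp (aodd a) (fun x => x ^ 2)); [eapply aodd_continuous; eauto|].
  apply continuity_pt_pow2.
Qed.

Lemma locally_between (x u v : R) : u < x < v -> locally x (fun t => u < t < v).
Proof.
intros [H1 H2]; apply filter_and; [apply (open_gt u)|apply (open_lt v)]; auto.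
Qed.

(** The angle has derivative [vel / gap] and [hub * vel] is the absolute value of [aodd], so
    [- dist_int] along the angle is a primitive. The integrand is kept abstract so that [rho_of] and
    [rhoM], written with different extensions of [a], are both instances. *)
Lemma Iimp_dist_int (a g : R -> R) (K C L tau t0 : R) :
  admissible a K C L -> - tau < t0 < tau ->
  (forall t, t0 < t < tau -> g t = Rabs (aodd a t) / gap a tau t) ->
  Iimp g t0 tau = dist_int (hubS a L) (a tau) (angle a tau t0).
Proof.
intros HA Ht0 Hg; assert (HP := admissible_profile _ _ _ _ HA).
assert (HH := hp_cont_H _ _ _ HP).
set (F t := - dist_int (hubS a L) (a tau) (angle a tau t)).
assert (CD : forall th, continuity_pt (dist_int (hubS a L) (a tau)) th).
{ intros th; apply continuity_2d_pt_section, continuity_2d_pt_dist_int, HH. }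
rewrite (Iimp_FTC g F t0 tau (F t0) 0); [unfold F; ring|lra| | | |].
- intros t Ht; rewrite Hg by auto; unfold F.
  assert (Htt : - tau < t < tau) by lra.
  assert (Hgp := gap_pos _ _ _ _ _ _ HA Htt).
  replace (Rabs (aodd a t) / gap a tau t)
    with (opp (scal (vel a L t / gap a tau t) (- hubS a L (a tau * sin (angle a tau t))))).
  + apply (is_derive_opp (fun t => dist_int (hubS a L) (a tau) (angle a tau t))).
    apply (is_derive_comp (dist_int (hubS a L) (a tau)) (angle a tau)).
    * apply is_derive_dist_int_th, HH.
    * apply (is_derive_angle _ _ _ _ _ _ HA); auto.
  + rewrite (sin_angle _ _ _ _ _ _ HA Htt), (hubS_aodd _ _ _ _ _ HA).
    unfold opp, scal; simpl; unfold mult; simpl.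
    (* When [L = 0], [vel] vanishes at [t = 0] and cannot be cancelled; there both sides are 0. *)
    destruct (Req_dec t 0) as [->|N].
    * rewrite (hub_0 _ _ _ _ HA), (Rabs_aodd _ _ _ _ _ HA), Rabs_R0, (a_0 _ _ _ _ HA).
      field; lra.
    * assert (Hv := vel_pos _ _ _ _ t HA N); unfold hub; field; lra.
- intros t Ht; assert (Htt : - tau < t < tau) by lra.
  apply continuity_pt_ext_locally with (fun t => Rabs (aodd a t) / gap a tau t).
  + apply filter_imp with (2 := locally_between _ _ _ Ht); intros u Hu; symmetry; auto.
  + apply (continuity_pt_div (fun t => Rabs (aodd a t)) (gap a tau)).
    * apply (continuity_pt_comp (aodd a) Rabs); [eapply aodd_continuous; eauto|].
      apply continuity_pt_Rabs.
    * eapply gap_continuous; eauto.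
    * apply Rgt_not_eq, (gap_pos _ _ _ _ _ _ HA); auto.
- apply (filterlim_at_right_of_continuity F), continuity_pt_opp.
  apply (continuity_pt_comp (angle a tau)); auto; apply (angle_continuous _ _ _ _ _ _ HA); auto.
- replace 0 with (- dist_int (hubS a L) (a tau) (PI / 2)) by (rewrite dist_int_PI2; ring).
  apply (filterlim_comp _ _ _ (angle a tau) (fun th => - dist_int (hubS a L) (a tau) th)
    _ (locally (PI / 2))).
  + apply (angle_at_left _ _ _ _ _ HA); lra.
  + assert (T := continuity_pt_opp _ _ (CD (PI / 2))); apply continuity_pt_filterlim in T.
    exact T.
Qed.

Lemma aext_eq (a : R -> R) (K C L t : R) : admissible a K C L -> aext a t = Rabs (aodd a t).
Proof. intros HA; unfold aext; now rewrite (Rabs_aodd _ _ _ _ _ HA). Qed.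

Lemma rho_of_eq (a : R -> R) (K C L tau t0 : R) :
  admissible a K C L -> - tau < t0 < tau ->
  rho_of a tau t0 = dist_int (hubS a L) (a tau) (angle a tau t0).
Proof.
intros HA Ht0; apply (Iimp_dist_int _ _ K C); auto; intros t Ht.
rewrite !(aext_eq _ _ _ _ _ HA), !pow2_abs, (aodd_nonneg a tau) by lra; reflexivity.
Qed.

Lemma angle_0 (a : R -> R) (K C L tau : R) : admissible a K C L -> angle a tau 0 = 0.
Proof.
intros HA; unfold angle; rewrite aodd_nonneg, (a_0 _ _ _ _ HA) by lra.
unfold Rdiv; rewrite Rmult_0_l; apply asin_0.
Qed.

Lemma rhoM_eq (a : R -> R) (K C L tau : R) :
  admissible a K C L -> 0 < tau -> rhoM a tau = dist_int (hubS a L) (a tau) 0.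
Proof.
intros HA Ht; rewrite <- (angle_0 _ _ _ _ tau HA).
apply (Iimp_dist_int _ _ K C); auto; [lra|]; intros t Htt.
rewrite (Rabs_aodd _ _ _ _ _ HA), Rabs_pos_eq by lra.
unfold gap; rewrite aodd_nonneg by lra; reflexivity.
Qed.

Lemma angle_opp (a : R -> R) (K C L tau t : R) :
  admissible a K C L -> angle a tau (- t) = - angle a tau t.
Proof.
intros HA; unfold angle; rewrite (aodd_opp _ _ _ _ _ HA), <- asin_opp; f_equal.
unfold Rdiv; ring.
Qed.

Lemma angle_nonneg (a : R -> R) (K C L tau t : R) :
  admissible a K C L -> 0 <= t < tau -> 0 <= angle a tau t.
Proof.
intros HA Ht; assert (Htt : - tau < t < tau) by lra.
assert (B := angle_bound _ _ _ _ _ _ HA Htt).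
assert (S := sin_angle _ _ _ _ _ _ HA Htt).
assert (Hp := a_pos _ _ _ _ tau HA ltac:(lra)).
destruct (Rle_dec 0 (angle a tau t)) as [H|H]; auto; exfalso.
assert (0 < sin (- angle a tau t)) by (apply sin_gt_0; lra).
rewrite sin_neg in H0.
assert (0 < a tau * - sin (angle a tau t)) by (apply Rmult_lt_0_compat; lra).
assert (0 <= aodd a t); [|lra].
rewrite aodd_nonneg by lra; destruct (proj1 Ht) as [H2|<-].
- apply Rlt_le, (a_pos _ _ _ _ _ HA); auto.
- rewrite (a_0 _ _ _ _ HA); lra.
Qed.

(* First summand of the antiderivative of the integrand of [f_pos] obtained by
   integrating [addot / adot ^ 2 = (- 1 / adot)'] by parts. *)
Definition parts_term (a : R -> R) (tau c t : R) : R :=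
  - (/ adot a t - / adot a tau) * (c / gap a tau t - 1).

Lemma is_derive_gap (a : R -> R) (K C L tau t : R) :
  admissible a K C L -> 0 < t < tau ->
  is_derive (gap a tau) t (- (a t * adot a t) / gap a tau t).
Proof.
intros HA Ht; assert (Htt : - tau < t < tau) by lra.
assert (Hg := gap_arg_pos _ _ _ _ _ _ HA Htt); assert (Hgp := gap_pos _ _ _ _ _ _ HA Htt).
assert (D := is_derive_a _ _ _ _ t HA (proj1 Ht)).
rewrite aodd_nonneg in Hg by lra; unfold gap in *; rewrite aodd_nonneg in * by lra.
apply is_derive_ext_loc with (fun t => sqrt (a tau ^ 2 - a t ^ 2)).
{ apply filter_imp with (2 := open_gt 0 t (proj1 Ht)); intros u Hu.
  now rewrite aodd_nonneg by lra. }
auto_derive.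
- repeat split; try (eexists; exact D); lra.
- replace (Derive (fun x => a x) t) with (adot a t)
    by (symmetry; apply is_derive_unique; exact D).
  replace (a tau * (a tau * 1) + - (a t * (a t * 1))) with (a tau ^ 2 - a t ^ 2) by ring.
  field; lra.
Qed.

Lemma is_derive_parts_term (a : R -> R) (K C L tau c t : R) :
  admissible a K C L -> 0 < t < tau ->
  is_derive (parts_term a tau c) t
    (addot a t / adot a t ^ 2 * (c / gap a tau t - 1)
     - (/ adot a t - / adot a tau) * (c * (a t * adot a t) / gap a tau t ^ 3)).
Proof.
intros HA Ht; assert (Htt : - tau < t < tau) by lra.
assert (Hgp := gap_pos _ _ _ _ _ _ HA Htt).
assert (D1 := is_derive_gap _ _ _ _ _ _ HA Ht).
assert (D2 := is_derive_adot _ _ _ _ t HA (proj1 Ht)).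
assert (Hd := adot_pos _ _ _ _ t HA (proj1 Ht)).
assert (Hd2 := adot_pos _ _ _ _ tau HA ltac:(lra)).
unfold parts_term; auto_derive.
- repeat split; try (eexists; eassumption); lra.
- replace (Derive (fun x => gap a tau x) t) with (- (a t * adot a t) / gap a tau t)
    by (symmetry; apply is_derive_unique; exact D1).
  replace (Derive (fun x => adot a x) t) with (addot a t)
    by (symmetry; apply is_derive_unique; exact D2).
  field; lra.
Qed.

Lemma filterlim_plus_R (F : (R -> Prop) -> Prop) (FF : Filter F) (f g : R -> R) (u v : R) :
  filterlim f F (locally u) -> filterlim g F (locally v) ->
  filterlim (fun t => f t + g t) F (locally (u + v)).
Proof.
intros Hf Hg; apply (filterlim_comp_2 f g Rplus Hf Hg).
apply (filterlim_plus (V := R_NormedModule) u v).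
Qed.

(** [c / gap] blows up at [tau]. The integration constant [/ adot a tau] makes the other factor of
    order [tau - t], which is at most of order [gap ^ 2], so the product is of order [gap]. *)
Lemma parts_term_at_left (a : R -> R) (K C L tau c : R) :
  admissible a K C L -> 0 < tau ->
  filterlim (parts_term a tau c) (at_left tau) (locally 0).
Proof.
intros HA Htau; apply filterlim_at_left_eps; intros eps He.
assert (Hd := adot_pos _ _ _ _ tau HA Htau); assert (Hp := a_pos _ _ _ _ tau HA Htau).
assert (D1 := is_derive_a _ _ _ _ tau HA Htau).
assert (D2 := is_derive_adot _ _ _ _ tau HA Htau).
assert (D3 : is_derive (fun t => / adot a t) tau (- addot a tau / adot a tau ^ 2)).
{ apply (is_derive_inv (adot a)); auto; lra. }
set (l := - addot a tau / adot a tau ^ 2) in *.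
destruct (is_derive_eps _ _ _ 1 D3 Rlt_0_1) as [d1 [Hd1 H1]].
destruct (is_derive_eps _ _ _ (adot a tau / 2) D1 ltac:(lra)) as [d2 [Hd2 H2]].
(* Quotient of two linear rates: the numerator controls [/ adot a t - / adot a tau], and the
   denominator is a lower rate for [gap ^ 2], obtained from [a tau - a t >= adot a tau / 2 * (tau -
   t)]. *)
set (M := (Rabs l + 1) / (a tau * adot a tau / 2)).
assert (Hq : 0 < a tau * adot a tau) by (apply Rmult_lt_0_compat; auto).
assert (HM : 0 < M).
{ apply Rdiv_lt_0_compat; [generalize (Rabs_pos l)|]; lra. }
assert (HG : continuity_pt (fun t => M * (Rabs c * gap a tau t + gap a tau t ^ 2)) tau).
{ assert (CG := gap_continuous _ _ _ _ tau tau HA).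
  apply (continuity_pt_mult (fun _ => M)); [apply continuity_pt_const; intro; auto|].
  apply (continuity_pt_plus (fun t => Rabs c * gap a tau t) (fun t => gap a tau t ^ 2)).
  - apply (continuity_pt_mult (fun _ => Rabs c)); auto; apply continuity_pt_const; intro; auto.
  - apply (continuity_pt_comp (gap a tau) (fun x => x ^ 2)); auto; apply continuity_pt_pow2. }
destruct (HG eps He) as [d3 [Hd3 H3]].
assert (G0 : gap a tau tau = 0).
{ unfold gap; rewrite aodd_nonneg, Rminus_diag by lra; apply sqrt_0. }
rewrite G0 in H3.
exists (Rmin (Rmin d1 d2) (Rmin d3 tau)); split; [repeat apply Rmin_pos; auto|].
intros t Ht.
assert (L1 := Rmin_l (Rmin d1 d2) (Rmin d3 tau)); assert (L2 := Rmin_r (Rmin d1 d2) (Rmin d3 tau)).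
assert (L3 := Rmin_l d1 d2); assert (L4 := Rmin_r d1 d2).
assert (L5 := Rmin_l d3 tau); assert (L6 := Rmin_r d3 tau).
assert (Htt : - tau < t < tau) by lra.
assert (Ab : Rabs (t - tau) = tau - t) by (rewrite Rabs_left; lra).
specialize (H1 t ltac:(lra)); specialize (H2 t ltac:(lra)); simpl in H1, H2.
rewrite Ab in H1, H2.
assert (Hg := gap_pos _ _ _ _ _ _ HA Htt).
assert (G2 : gap a tau t ^ 2 = a tau ^ 2 - a t ^ 2).
{ unfold gap; rewrite pow2_sqrt; [|apply Rlt_le, (gap_arg_pos _ _ _ _ _ _ HA); auto].
  rewrite aodd_nonneg; lra. }
assert (B1 : Rabs (/ adot a t - / adot a tau) <= (Rabs l + 1) * (tau - t)).
{ replace (/ adot a t - / adot a tau)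
    with ((/ adot a t - / adot a tau - l * (t - tau)) + l * (t - tau)) by ring.
  apply Rle_trans with (1 := Rabs_triang _ _); rewrite (Rabs_mult l), Ab; lra. }
assert (B2 : a tau * adot a tau / 2 * (tau - t) <= gap a tau t ^ 2).
{ rewrite G2; apply Rabs_le_between in H2.
  assert (Hat : adot a tau / 2 * (tau - t) <= a tau - a t) by lra.
  assert (Hpt := a_pos _ _ _ _ t HA ltac:(lra)).
  replace (a tau ^ 2 - a t ^ 2) with (a tau * (a tau - a t) + a t * (a tau - a t)) by ring.
  assert (a tau * (adot a tau / 2 * (tau - t)) <= a tau * (a tau - a t))
    by (apply Rmult_le_compat_l; lra).
  assert (0 < adot a tau / 2 * (tau - t)) by (apply Rmult_lt_0_compat; lra).
  assert (0 <= a t * (a tau - a t)) by (apply Rmult_le_pos; lra); lra. }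
assert (B3 : Rabs (/ adot a t - / adot a tau) <= M * gap a tau t ^ 2).
{ apply Rle_trans with (1 := B1).
  apply Rle_trans with (M * (a tau * adot a tau / 2 * (tau - t)));
    [right; unfold M; field; lra|apply Rmult_le_compat_l; lra]. }
assert (B4 : Rabs (parts_term a tau c t)
             <= M * (Rabs c * gap a tau t + gap a tau t ^ 2)).
{ unfold parts_term; rewrite Rabs_mult, Rabs_Ropp.
  replace (M * (Rabs c * gap a tau t + gap a tau t ^ 2))
    with (M * gap a tau t ^ 2 * (Rabs c / gap a tau t + 1)) by (field; lra).
  apply Rmult_le_compat; auto; try apply Rabs_pos.
  apply Rle_trans with (1 := Rabs_triang _ _).
  rewrite Rabs_Ropp, Rabs_R1, Rabs_div, (Rabs_pos_eq (gap a tau t)); lra. }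
rewrite Rminus_0_r; apply Rle_lt_trans with (1 := B4).
assert (B5 : Rabs (M * (Rabs c * gap a tau t + gap a tau t ^ 2)
                   - M * (Rabs c * 0 + 0 ^ 2)) < eps).
{ apply (H3 t); split; [split; [exact I|lra]|]; simpl; unfold Rdist; lra. }
replace (M * (Rabs c * 0 + 0 ^ 2)) with 0 in B5 by ring.
rewrite Rminus_0_r in B5; apply Rle_lt_trans with (2 := B5), Rle_abs.
Qed.

(** With [c = gap a tau t0] the factor [c / gap - 1] vanishes at [t0]. For [t0 > 0] the other factor
    is continuous there, and [t0 = 0] is treated apart. *)
Lemma parts_term_at_right (a : R -> R) (K C L tau t0 : R) :
  admissible a K C L -> 0 <= t0 < tau ->
  filterlim (parts_term a tau (gap a tau t0)) (at_right t0) (locally 0).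
Proof.
intros HA Ht0; destruct (Rle_lt_or_eq_dec 0 t0 (proj1 Ht0)) as [H|<-].
- assert (Hg := gap_pos _ _ _ _ tau t0 HA ltac:(lra)).
  replace 0 with (parts_term a tau (gap a tau t0) t0) by (unfold parts_term; field;
    repeat split; try lra; apply Rgt_not_eq, (adot_pos _ _ _ _ _ HA); lra).
  apply filterlim_at_right_of_continuity; eapply is_derive_continuity_pt.
  apply (is_derive_parts_term _ _ _ _ _ _ _ HA); lra.
- assert (Hp := a_pos _ _ _ _ tau HA ltac:(lra)).
  assert (G0 : gap a tau 0 = a tau).
  { unfold gap; rewrite aodd_nonneg, (a_0 _ _ _ _ HA) by lra.
    replace (a tau ^ 2 - 0 ^ 2) with ((a tau)²) by (unfold Rsqr; ring).
    apply sqrt_Rsqr; lra. }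
  rewrite G0.
  (* [a tau / gap - 1 = a ^ 2 / (gap * (a tau + gap))] cancels the possible pole of
     [/ adot] at [0], since [a / adot] tends to [0]. *)
  set (num t := - (hub a L t * aodd a t - / adot a tau * aodd a t ^ 2)).
  set (den t := gap a tau t * (a tau + gap a tau t)).
  apply filterlim_ext_loc with (fun t => num t / den t).
  + exists (mkposreal tau (proj2 Ht0)); simpl; intros t Ht Htp.
    change (Rabs (t - 0) < tau) in Ht; rewrite Rminus_0_r, Rabs_pos_eq in Ht by lra.
    assert (Htt : - tau < t < tau) by lra.
    assert (Hg := gap_pos _ _ _ _ _ _ HA Htt).
    assert (G2 : aodd a t ^ 2 = a tau ^ 2 - gap a tau t ^ 2).
    { unfold gap; rewrite pow2_sqrt; [ring|apply Rlt_le, (gap_arg_pos _ _ _ _ _ _ HA); auto]. }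
    unfold num, den, parts_term; rewrite (hub_pos_eq _ _ _ _ _ HA Htp).
    assert (Hd := adot_pos _ _ _ _ t HA Htp).
    assert (Hd2 := adot_pos _ _ _ _ tau HA ltac:(lra)).
    rewrite <- (aodd_nonneg a t) by lra.
    replace (aodd a t / adot a t * aodd a t) with (aodd a t ^ 2 / adot a t) by (field; lra).
    rewrite G2; field; lra.
  + replace 0 with (num 0 / den 0) at 2.
    2:{ unfold num; rewrite (hub_0 _ _ _ _ HA), aodd_nonneg, (a_0 _ _ _ _ HA) by lra.
        unfold Rdiv; ring. }
    assert (CG := gap_continuous _ _ _ _ tau 0 HA).
    assert (CO := aodd_continuous _ _ _ _ 0 HA).
    apply (filterlim_at_right_of_continuity (fun t => num t / den t)).
    apply (continuity_pt_div num den).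
    * apply continuity_pt_opp, (continuity_pt_minus (fun t => hub a L t * aodd a t)
        (fun t => / adot a tau * aodd a t ^ 2)).
      -- apply (continuity_pt_mult (hub a L) (aodd a)); auto; eapply hub_continuous; eauto.
      -- apply (continuity_pt_mult (fun _ => / adot a tau)).
         ++ apply continuity_pt_const; intro; auto.
         ++ apply (continuity_pt_comp (aodd a) (fun x => x ^ 2)); auto; apply continuity_pt_pow2.
    * apply (continuity_pt_mult (gap a tau) (fun t => a tau + gap a tau t)); auto.
      apply (continuity_pt_plus (fun _ => a tau)); auto; apply continuity_pt_const; intro; auto.
    * unfold den; rewrite G0; apply Rgt_not_eq, Rmult_lt_0_compat; lra.
Qed.

(** Differentiating [parts_term] leaves the extra term [(/ adot a t - / adot a tau) * c * a t * adot
    a t / gap ^ 3]. In the angle variable this is [c / A ^ 2] times the integrand of [J], which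
    explains the second summand of the primitive [F]. The boundary values of [parts_term] and [J] at
    [PI / 2] are 0, so only [J] at the lower end survives. *)
Lemma f_pos_eq (a : R -> R) (K C L tau t0 : R) :
  admissible a K C L -> 0 <= t0 < tau ->
  f_pos a tau t0 = half_shift (hubS a L) (a tau) (angle a tau t0).
Proof.
intros HA Ht0; assert (HP := admissible_profile _ _ _ _ HA).
assert (HH := hp_cont_H _ _ _ HP); assert (HL := hp_lip_H _ _ _ HP).
assert (Htau : 0 < tau) by lra; assert (Htt0 : - tau < t0 < tau) by lra.
assert (Hp := a_pos _ _ _ _ tau HA Htau); assert (HP1 := PI_half_gt_1).
set (A := a tau) in *; set (c := gap a tau t0).
set (J th := kern_int (hubS a L) A th).
set (F t := parts_term a tau c t + - (c / A ^ 2) * J (angle a tau t)).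
assert (CJ : forall th, Rabs th < PI / 2 -> continuity_pt J th).
{ intros th Hth; apply (continuity_2d_pt_section (kern_int (hubS a L))).
  apply continuity_2d_pt_kern_int; auto. }
assert (Ec : forall t, 0 <= t -> gap a tau t = sqrt (A ^ 2 - a t ^ 2)).
{ intros t Ht; unfold gap; now rewrite aodd_nonneg. }
assert (HAdot := adot_pos _ _ _ _ tau HA Htau).
assert (HHA : hubS a L A = A / adot a tau).
{ unfold A; rewrite <- (aodd_nonneg a tau) at 1 by lra.
  rewrite (hubS_aodd _ _ _ _ _ HA); apply (hub_pos_eq _ _ _ _ _ HA); auto. }
unfold f_pos; fold A.
rewrite (Iimp_FTC _ F t0 tau (0 + - (c / A ^ 2) * J (angle a tau t0)) (0 + - (c / A ^ 2) * 0));
  [|lra| | | |].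
- unfold half_shift, J; rewrite (cos_angle _ _ _ _ _ _ HA Htt0); fold c A; field; lra.
- intros t Ht; unfold F; assert (Htt : - tau < t < tau) by lra.
  rewrite <- (Ec t0), <- (Ec t) by lra; fold c.
  assert (Hg := gap_pos _ _ _ _ _ _ HA Htt); assert (Ht1 : 0 < t < tau) by lra.
  assert (Hd := adot_pos _ _ _ _ t HA (proj1 Ht1)).
  assert (HJ : is_derive (fun t => J (angle a tau t)) t
     (scal (vel a L t / gap a tau t)
       (- ((hubS a L (A * sin (angle a tau t)) - sin (angle a tau t) * hubS a L A)
            / cos (angle a tau t) ^ 2)))).
  { apply (is_derive_comp J (angle a tau)).
    - apply is_derive_kern_int_th; auto; split.
      + assert (S := sin_angle _ _ _ _ _ _ HA Htt); rewrite aodd_nonneg in S by lra.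
        destruct (angle_nonneg _ _ _ _ tau t HA ltac:(lra)) as [H|H]; auto.
        rewrite <- H, sin_0, Rmult_0_r in S.
        generalize (a_pos _ _ _ _ t HA (proj1 Ht1)); lra.
      + apply (angle_bound _ _ _ _ _ _ HA Htt).
    - apply (is_derive_angle _ _ _ _ _ _ HA); auto. }
  replace (addot a t / adot a t ^ 2 * (c / gap a tau t - 1)) with
   (plus (addot a t / adot a t ^ 2 * (c / gap a tau t - 1)
     - (/ adot a t - / adot a tau) * (c * (a t * adot a t) / gap a tau t ^ 3))
    (scal (- (c / A ^ 2)) (scal (vel a L t / gap a tau t)
       (- ((hubS a L (A * sin (angle a tau t)) - sin (angle a tau t) * hubS a L A)
            / cos (angle a tau t) ^ 2))))).
  + apply (is_derive_plus (parts_term a tau c) (fun t => - (c / A ^ 2) * J (angle a tau t))).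
    * apply (is_derive_parts_term _ _ _ _ _ _ _ HA); auto.
    * apply (is_derive_scal (fun t => J (angle a tau t))); auto.
  + rewrite (cos_angle _ _ _ _ _ _ HA Htt), HHA.
    replace (sin (angle a tau t)) with (a t / A)
      by (rewrite <- (aodd_nonneg a t), <- (sin_angle _ _ _ _ _ _ HA Htt) by lra;
          fold A; field; lra).
    replace (A * (a t / A)) with (aodd a t) by (rewrite aodd_nonneg by lra; field; lra).
    rewrite (hubS_aodd _ _ _ _ _ HA), (hub_pos_eq _ _ _ _ _ HA), vel_neq0, Rabs_pos_eq by lra.
    fold A; unfold plus, scal; simpl; unfold mult; simpl; field; lra.
- intros t Ht; assert (Htt : - tau < t < tau) by lra; assert (Ht1 : 0 < t) by lra.
  assert (Hg := gap_pos _ _ _ _ _ _ HA Htt).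
  assert (Hd := adot_pos _ _ _ _ t HA Ht1).
  apply continuity_pt_ext_locally with
    (fun t => addot a t / adot a t ^ 2 * (c / gap a tau t - 1)).
  { apply filter_imp with (2 := locally_between _ _ _ Ht); intros u Hu.
    unfold c; rewrite !Ec by lra; reflexivity. }
  apply (continuity_pt_mult (fun t => addot a t / adot a t ^ 2) (fun t => c / gap a tau t - 1)).
  + apply (continuity_pt_div (addot a) (fun t => adot a t ^ 2)).
    * eapply is_derive_continuity_pt, is_derive_addot; eauto.
    * apply (continuity_pt_comp (adot a) (fun x => x ^ 2)); [|apply continuity_pt_pow2].
      eapply is_derive_continuity_pt, is_derive_adot; eauto.
    * apply Rgt_not_eq, pow_lt; auto.
  + apply (continuity_pt_minus (fun t => c / gap a tau t) (fun _ => 1)).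
    * apply (continuity_pt_div (fun _ => c) (gap a tau)); [| |lra].
      -- apply continuity_pt_const; intro; auto.
      -- eapply gap_continuous; eauto.
    * apply continuity_pt_const; intro; auto.
- apply (filterlim_plus_R (at_right t0) _ (parts_term a tau c)
    (fun t => - (c / A ^ 2) * J (angle a tau t))).
  + apply (parts_term_at_right _ _ _ _ _ _ HA); auto.
  + apply (filterlim_at_right_of_continuity (fun t => - (c / A ^ 2) * J (angle a tau t))).
    apply (continuity_pt_mult (fun _ => - (c / A ^ 2)) (fun t => J (angle a tau t))).
    * apply continuity_pt_const; intro; auto.
    * apply (continuity_pt_comp (angle a tau) J).
      -- apply (angle_continuous _ _ _ _ _ _ HA); auto.
      -- apply CJ, Rabs_def1; generalize (angle_bound _ _ _ _ _ _ HA Htt0); lra.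
- apply (filterlim_plus_R (at_left tau) _ (parts_term a tau c)
    (fun t => - (c / A ^ 2) * J (angle a tau t))).
  + apply (parts_term_at_left _ _ _ _ _ _ HA); auto.
  (* At [PI / 2] the upper limit of the integral is 0. Continuity there comes from continuity of
     [kern] at [x = 0], applied to a degenerate base segment. *)
  + set (X x := RInt (kern (hubS a L) A) 0 (sqrt (PI / 2 - Rabs x))).
    replace 0 with (X (PI / 2)).
    2:{ unfold X; rewrite Rabs_pos_eq, Rminus_diag, sqrt_0 by lra.
        apply (RInt_point (V := R_CompleteNormedModule)). }
    apply (filterlim_comp _ _ _ (angle a tau) (fun th => - (c / A ^ 2) * J th)
      _ (locally (PI / 2))); [apply (angle_at_left _ _ _ _ _ HA); auto|].
    apply (continuity_pt_filterlim (fun th => - (c / A ^ 2) * J th)).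
    apply (continuity_pt_mult (fun _ => - (c / A ^ 2)) J).
    * apply continuity_pt_const; intro; auto.
    * apply (continuity_pt_comp (fun th => sqrt (PI / 2 - Rabs th))
        (fun x => RInt (kern (hubS a L) A) 0 x)).
      -- apply continuity_pt_filterlim, (continuous_sqrt_comp (fun v => PI / 2 - Rabs v)).
         apply (continuous_minus (fun _ => PI / 2) Rabs); [apply continuous_const|].
         apply continuous_Rabs.
      -- rewrite Rabs_pos_eq, Rminus_diag, sqrt_0 by lra.
         apply (continuity_2d_pt_section (fun A x => RInt (kern (hubS a L) A) 0 x)).
         assert (Hm : 0 < Rmin A 1) by (apply Rmin_pos; lra).
         assert (M1 := Rmin_l A 1); assert (M2 := Rmin_r A 1).
         set (m := Rmin A 1) in *.
         apply continuity_2d_pt_RInt with m; auto.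
         rewrite Rmin_left, Rmax_left by lra; intros B x HB Hx.
         apply Rabs_def2 in HB; apply continuity_2d_pt_kern; auto; [apply HL; lra|lra|].
         assert (0 < (1 - x) * (1 + x)) by (apply Rmult_lt_0_compat; lra); lra.
Qed.

(** The angle is odd in [t0] and [half_shift] is even in the angle, so the defining rule for
    negative [t0] becomes [odd_reflection]. *)
Lemma f_fun_eq (a : R -> R) (K C L tau t0 : R) :
  admissible a K C L -> - tau < t0 < tau ->
  f_fun a tau t0 = odd_reflection (half_shift (hubS a L) (a tau)) (angle a tau t0).
Proof.
intros HA Ht0; unfold f_fun; destruct (Rle_dec 0 t0) as [H|H].
- rewrite odd_reflection_nonneg by (apply (angle_nonneg _ _ _ _ _ _ HA); lra).
  apply (f_pos_eq _ K C); auto; lra.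
- assert (N := angle_nonneg _ _ _ _ tau (- t0) HA ltac:(lra)).
  rewrite (f_pos_eq _ K C L), (f_pos_eq _ K C L tau (- t0)) by (auto; lra).
  rewrite (angle_opp _ _ _ _ _ _ HA) in *.
  rewrite odd_reflection_neg, (angle_0 _ _ _ _ _ HA), half_shift_opp by lra; reflexivity.
Qed.

(** * Differentiability on the domain *)

(** The point is that [a / adot] tends to 0. With a positive limit [L] the denominator eventually
    exceeds [L / 2] while [a] tends to 0; with limit 0, convexity near 0 is used. *)
Lemma admissible_of_hyps (a : R -> R) (K C : R) :
  strongly_regular_scale_factor a K ->
  ( (filterlim (adot a) (at_right 0) (locally 0) /\
     exists eps, 0 < eps /\ forall t, 0 < t < eps -> 0 <= addot a t)
    \/
    (exists L, 0 < L /\ filterlim (adot a) (at_right 0) (locally L)) ) ->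
  (forall t, 0 < t ->
     ex_derive (addot a) t /\
     Rabs (adddot a t * a t ^ 2 / (adot a t) ^ 3) <= C) ->
  exists L, admissible a K C L.
Proof.
intros HR Hcase H3.
destruct (proj1 HR) as [H0 [Hi [Hc [Hd [Hn _]]]]].
assert (Da : forall t, 0 < t -> is_derive a t (adot a t)).
{ intros t Ht; apply Derive_correct, Hd; auto. }
assert (Pd : forall t, 0 < t -> 0 < adot a t).
{ intros t Ht; assert (0 <= adot a t).
  { apply (is_derive_nonneg_of_incr a t (adot a t) 1); [lra| |auto].
    intros u Hu; apply Rlt_le, Hi; lra. }
  specialize (Hn t Ht); lra. }
assert (Ca : forall eps, 0 < eps -> exists d, 0 < d /\ forall t, 0 < t < d -> 0 < a t < eps).
{ intros eps He; destruct (Hc 0 (Rle_refl 0) (fun y => Rabs (y - a 0) < eps)) as [d Hdd].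
  { exists (mkposreal _ He); intros y Hy; exact Hy. }
  exists d; split; [apply cond_pos|]; intros t Ht.
  assert (Hp : 0 < a t) by (rewrite <- H0; apply Hi; lra).
  split; auto; specialize (Hdd t); rewrite H0, Rminus_0_r in Hdd.
  apply Rle_lt_trans with (1 := Rle_abs _); apply Hdd; [|lra].
  change (Rabs (t - 0) < d); rewrite Rminus_0_r, Rabs_pos_eq; lra. }
assert (Hfl : forall f : R -> R,
  (forall eps, 0 < eps -> exists d, 0 < d /\ forall t, 0 < t < d -> Rabs (f t) < eps) ->
  filterlim f (at_right 0) (locally 0)).
{ intros f Hf Q [e He]; destruct (Hf e (cond_pos e)) as [d [Hd1 Hd2]].
  exists (mkposreal _ Hd1); simpl; intros t Ht Htp; apply He.
  change (Rabs (f t - 0) < e); rewrite Rminus_0_r; apply Hd2; split; auto.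
  change (Rabs (t - 0) < d) in Ht; rewrite Rminus_0_r in Ht.
  apply Rle_lt_trans with (2 := Ht), Rle_abs. }
destruct Hcase as [[HL [e [He Hdd]]]|[L [HLp HLim]]].
- exists 0; split; auto; apply Hfl; intros eps Heps.
  (* [adot] is nondecreasing near [0], so [a t <= t * adot t]. *)
  exists (Rmin e eps); split; [apply Rmin_pos; auto|]; intros t Ht.
  assert (L1 := Rmin_l e eps); assert (L2 := Rmin_r e eps).
  assert (Ht0 : 0 < t) by lra.
  assert (Mon : forall s, 0 < s <= t -> adot a s <= adot a t).
  { intros s Hs; apply (derive_nonneg_le (adot a) (addot a)); [lra| | |].
    - intros u Hu; apply (Derive_correct (Derive a)), Hd; lra.
    - intros u Hu; eapply is_derive_continuity_pt, (Derive_correct (Derive a)), Hd; lra.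
    - intros u Hu; apply Hdd; lra. }
  assert (Hle : a t <= t * adot a t).
  (* Since [adot a t * u - a u] increases in [u] up to [t], a positive defect [a t - t * adot a t]
     would be a lower bound for [a s] at every [0 < s <= t], against [a s -> 0]. Stopping at [s > 0]
     avoids differentiating at 0. *)
  { apply Rnot_lt_le; intros Hlt.
    destruct (Ca (a t - t * adot a t)) as [d [Hd0 Hsm]]; [lra|].
    set (s := Rmin (d / 2) t).
    assert (S1 : s <= d / 2) by apply Rmin_l; assert (S2 : s <= t) by apply Rmin_r.
    assert (S3 : 0 < s) by (apply Rmin_pos; lra).
    specialize (Hsm s ltac:(lra)).
    assert (T : adot a t * s - a s <= adot a t * t - a t).
    { apply (derive_nonneg_le (fun u => adot a t * u - a u) (fun u => adot a t - adot a u)); auto.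
      - intros u Hu; apply (is_derive_minus (fun u => adot a t * u) a); [|apply Da; lra].
        auto_derive; auto; ring.
      - intros u Hu; apply (continuity_pt_minus (fun u => adot a t * u) a).
        + apply is_derive_continuity_pt with (adot a t); auto_derive; auto; ring.
        + eapply is_derive_continuity_pt, Da; lra.
      - intros u Hu; specialize (Mon u ltac:(lra)); lra. }
    assert (0 < adot a t * s) by (apply Rmult_lt_0_compat; auto); lra. }
  assert (Hp : 0 < a t) by (rewrite <- H0; apply Hi; lra).
  rewrite Rabs_pos_eq by (apply Rlt_le, Rdiv_lt_0_compat; auto).
  apply Rle_lt_trans with t; [|lra]; apply Rle_div_l; [apply Pd|]; auto.
- exists L; split; auto; apply Hfl; intros eps Heps.
  destruct (at_right_eps _ _ _ (L / 2) HLim) as [d1 [Hd1 B1]]; [lra|].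
  destruct (Ca (eps * (L / 2))) as [d2 [Hd2 B2]]; [apply Rmult_lt_0_compat; lra|].
  exists (Rmin d1 d2); split; [apply Rmin_pos; auto|]; intros t Ht.
  assert (L1 := Rmin_l d1 d2); assert (L2 := Rmin_r d1 d2).
  specialize (B1 t ltac:(lra)); specialize (B2 t ltac:(lra)).
  apply Rabs_def2 in B1.
  rewrite Rabs_pos_eq by (apply Rlt_le, Rdiv_lt_0_compat; lra).
  apply Rlt_div_l; [lra|].
  assert (eps * (L / 2) < eps * adot a t) by (apply Rmult_lt_compat_l; lra); lra.
Qed.

Lemma continuity_2d_pt_pos (f : R -> R -> R) (x y : R) :
  continuity_2d_pt f x y -> 0 < f x y -> locally_2d (fun u v => 0 < f u v) x y.
Proof.
intros Hf H; apply locally_2d_impl with (2 := Hf (mkposreal _ H)).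
apply locally_2d_forall; simpl; intros u v Huv; apply Rabs_def2 in Huv; lra.
Qed.

(** * The domain and the inversion of the distance *)

Definition fermi_dist (a : R -> R) (L tau th : R) : R := dist_int (hubS a L) (a tau) th.

Lemma continuity_2d_pt_a_fst (a : R -> R) (K C L x y : R) :
  admissible a K C L -> 0 < x -> continuity_2d_pt (fun u _ => a u) x y.
Proof.
intros HA Hx; apply continuity_2d_pt_fst; eapply is_derive_continuity_pt, is_derive_a; eauto.
Qed.

Lemma continuity_2d_pt_fermi_dist (a : R -> R) (K C L x th : R) :
  admissible a K C L -> 0 < x -> continuity_2d_pt (fermi_dist a L) x th.
Proof.
intros HA Hx; unfold fermi_dist.
apply (continuity_2d_pt_comp2 (dist_int (hubS a L)) (fun u _ => a u) (fun _ v => v)).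
- apply continuity_2d_pt_dist_int, (hp_cont_H _ _ _ (admissible_profile _ _ _ _ HA)).
- eapply continuity_2d_pt_a_fst; eauto.
- apply continuity_2d_pt_id2.
Qed.

(** [2 * rhoM] is the distance at angle [- (PI / 2)], so the slice of the domain at [x] is the open
    interval between the distances at the two extreme angles. *)
Lemma domD_iff (a : R -> R) (K C L x y : R) :
  admissible a K C L ->
  (domD a x y <-> 0 < x /\ 0 < y < fermi_dist a L x (- (PI / 2))).
Proof.
intros HA; unfold domD, fermi_dist.
rewrite (dist_int_opp _ _ _ _ _ (admissible_profile _ _ _ _ HA)), dist_int_PI2, Rminus_0_r.
split; intros [Hx Hy]; rewrite (rhoM_eq _ _ _ _ _ HA Hx) in *; tauto.
Qed.

Lemma continuity_2d_pt_fermi_dist_minus (a : R -> R) (K C L c x y : R) :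
  admissible a K C L -> 0 < x -> continuity_2d_pt (fun u v => fermi_dist a L u c - v) x y.
Proof.
intros HA Hx; apply (continuity_2d_pt_minus (fun u _ => fermi_dist a L u c) (fun _ v => v)).
- apply (continuity_2d_pt_comp2 (fermi_dist a L) (fun u _ => u) (fun _ _ => c)).
  + eapply continuity_2d_pt_fermi_dist; eauto.
  + apply continuity_2d_pt_id1.
  + apply continuity_2d_pt_const.
- apply continuity_2d_pt_id2.
Qed.

Lemma domD_open (a : R -> R) (K C L x y : R) :
  admissible a K C L -> domD a x y -> locally_2d (domD a) x y.
Proof.
intros HA HD; apply (domD_iff _ _ _ _ _ _ HA) in HD; destruct HD as [Hx [Hy1 Hy2]].
assert (P1 := continuity_2d_pt_pos _ _ _ (continuity_2d_pt_id1 x y) Hx).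
assert (P2 := continuity_2d_pt_pos _ _ _ (continuity_2d_pt_id2 x y) Hy1).
assert (P3 := continuity_2d_pt_pos _ _ _
  (continuity_2d_pt_fermi_dist_minus _ _ _ _ (- (PI / 2)) x y HA Hx) ltac:(cbv beta; lra)).
apply locally_2d_impl with (2 := locally_2d_and _ _ _ _ P1 (locally_2d_and _ _ _ _ P2 P3)).
apply locally_2d_forall; intros u v [H1 [H2 H3]].
apply (domD_iff _ _ _ _ _ _ HA); lra.
Qed.

Definition angle_of (a : R -> R) (x y : R) : R := angle a x (t0_of a x y).

(** The intermediate value theorem yields an angle, and the strict bounds on [y] exclude [PI / 2]
    and [- (PI / 2)]. The witness is the time whose odd scale factor is [a x * sin th]. *)
Lemma t0_of_spec (a : R -> R) (K C L x y : R) :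
  admissible a K C L -> domD a x y ->
  - x < t0_of a x y < x /\ y = rho_of a x (t0_of a x y).
Proof.
intros HA HD; apply (domD_iff _ _ _ _ _ _ HA) in HD; destruct HD as [Hx [Hy1 Hy2]].
unfold t0_of; apply (epsilon_spec (inhabits 0)
  (fun t0 => - x < t0 < x /\ y = rho_of a x t0)).
assert (HP := admissible_profile _ _ _ _ HA); assert (HP1 := PI_half_gt_1).
assert (E2 := dist_int_PI2 (hubS a L) (a x)); unfold fermi_dist in Hy2.
destruct (IVT_gen (dist_int (hubS a L) (a x)) (- (PI / 2)) (PI / 2) y) as [th [Hth Eth]].
{ intro; apply continuity_2d_pt_section, continuity_2d_pt_dist_int, (hp_cont_H _ _ _ HP). }
{ rewrite Rmin_right, Rmax_left by lra; lra. }
rewrite Rmin_left, Rmax_right in Hth by lra.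
assert (B1 : th <> PI / 2) by (intros ->; lra).
assert (B2 : th <> - (PI / 2)) by (intros ->; lra).
assert (Hc : 0 < cos th) by (apply cos_gt_0; lra).
assert (S : -1 < sin th < 1).
{ assert (T := sin2_cos2 th); unfold Rsqr in T; nra. }
assert (Hp := a_pos _ _ _ _ x HA Hx).
set (t := ainv a (a x * sin th)).
assert (Et : aodd a t = a x * sin th) by apply (aodd_ainv _ _ _ _ _ HA).
assert (Ht : - x < t < x).
{ split.
  - apply (ainv_gt _ _ _ _ _ _ HA); rewrite (aodd_opp _ _ _ _ _ HA), aodd_nonneg by lra; nra.
  - apply (ainv_lt _ _ _ _ _ _ HA); rewrite aodd_nonneg by lra; nra. }
exists t; split; auto.
rewrite (rho_of_eq _ _ _ _ _ _ HA Ht), <- Eth; f_equal.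
unfold angle; rewrite Et; replace (a x * sin th / a x) with (sin th) by (field; lra).
symmetry; apply asin_sin; lra.
Qed.

Lemma angle_of_spec (a : R -> R) (K C L x y : R) :
  admissible a K C L -> domD a x y ->
  Rabs (angle_of a x y) < PI / 2 /\ fermi_dist a L x (angle_of a x y) = y.
Proof.
intros HA HD; destruct (t0_of_spec _ _ _ _ _ _ HA HD) as [Ht Ey].
rewrite (rho_of_eq _ _ _ _ _ _ HA Ht) in Ey; split; [|symmetry; exact Ey].
assert (B := angle_bound _ _ _ _ _ _ HA Ht); apply Rabs_def1; apply B.
Qed.

(** The implicit function theorem fails at angle 0, so monotonicity is used: the strict inequalities
    at [th - e] and [th + e] persist for nearby [(u, v)] and trap the angle between these two
    values. *)
Lemma angle_of_continuous (a : R -> R) (K C L x y : R) :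
  admissible a K C L -> domD a x y -> continuity_2d_pt (angle_of a) x y.
Proof.
intros HA HD eps; assert (HP := admissible_profile _ _ _ _ HA).
destruct (angle_of_spec _ _ _ _ _ _ HA HD) as [B E].
assert (Hx : 0 < x) by apply HD.
set (th := angle_of a x y) in *; apply Rabs_def2 in B.
set (e := Rmin eps (Rmin (PI / 2 - th) (th + PI / 2))).
assert (He : 0 < e) by (repeat apply Rmin_pos; try apply cond_pos; lra).
assert (L1 : e <= eps) by apply Rmin_l.
assert (L2 : e <= PI / 2 - th) by (apply Rle_trans with (1 := Rmin_r _ _), Rmin_l).
assert (L3 : e <= th + PI / 2) by (apply Rle_trans with (1 := Rmin_r _ _), Rmin_r).
assert (Hp := a_pos _ _ _ _ x HA Hx).
assert (D1 : fermi_dist a L x (th + e) < y).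
{ rewrite <- E; apply (dist_int_strict_decr _ _ _ _ _ _ HP); lra. }
assert (D2 : y < fermi_dist a L x (th - e)).
{ rewrite <- E at 1; apply (dist_int_strict_decr _ _ _ _ _ _ HP); lra. }
assert (P1 := continuity_2d_pt_pos _ _ _ (continuity_2d_pt_opp _ _ _
  (continuity_2d_pt_fermi_dist_minus _ _ _ _ (th + e) x y HA Hx)) ltac:(cbv beta; lra)).
assert (P2 := continuity_2d_pt_pos _ _ _
  (continuity_2d_pt_fermi_dist_minus _ _ _ _ (th - e) x y HA Hx) ltac:(cbv beta; lra)).
apply locally_2d_impl with
  (2 := locally_2d_and _ _ _ _ (domD_open _ _ _ _ _ _ HA HD) (locally_2d_and _ _ _ _ P1 P2)).
apply locally_2d_forall; intros u v [HDu [H1 H2]].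
destruct (angle_of_spec _ _ _ _ _ _ HA HDu) as [_ Eu].
assert (T1 : angle_of a u v < th + e).
{ apply Rnot_le_lt; intros N; apply (dist_int_decr _ _ _ (a u) _ _ HP) in N.
  change (fermi_dist a L u (angle_of a u v) <= fermi_dist a L u (th + e)) in N; lra. }
assert (T2 : th - e < angle_of a u v).
{ apply Rnot_le_lt; intros N; apply (dist_int_decr _ _ _ (a u) _ _ HP) in N.
  change (fermi_dist a L u (th - e) <= fermi_dist a L u (angle_of a u v)) in N; lra. }
fold th; apply Rabs_def1; lra.
Qed.

(** * The gradient of the shift in the coordinates [(tau, rho)] *)

Definition signed_shift (a : R -> R) (L A th : R) : R := odd_reflection (half_shift (hubS a L) A) th.

Definition signed_shift_A (a : R -> R) (L A th : R) : R :=
  odd_reflection (half_shift_A (hubS a L) (hublS a L) A) th.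

Definition rho_slope (a : R -> R) (L A th : R) : R := shift_slope (hubS a L) (velS a L) A th.

(** The derivative in [A] at fixed rho instead of fixed angle: holding rho constant moves the angle,
    which contributes minus the slope times the [A]-derivative of the distance. The remaining factor
    [adot] enters when [A = a x] is substituted. *)
Definition signed_shift_tau (a : R -> R) (L A th : R) : R :=
  signed_shift_A a L A th - rho_slope a L A th * (dist_int (hublS a L) A th / A).

Definition shift_on_D (a : R -> R) (L x y : R) : R := signed_shift a L (a x) (angle_of a x y).

Lemma f_fun_shift_on_D (a : R -> R) (K C L x y : R) :
  admissible a K C L -> domD a x y -> f_fun a x (t0_of a x y) = shift_on_D a L x y.
Proof.
intros HA HD; apply (f_fun_eq _ _ _ _ _ _ HA), (t0_of_spec _ _ _ _ _ _ HA HD).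
Qed.

(** An instance of [differentiable_along_level] with the distance as [S], the shift as [P] and the
    angle as [T]; derivatives in [A] become derivatives in [x] by composition with [a]. *)
Lemma differentiable_shift_on_D (a : R -> R) (K C L x y : R) :
  admissible a K C L -> domD a x y ->
  differentiable_pt_lim (shift_on_D a L) x y
    (signed_shift_tau a L (a x) (angle_of a x y) * adot a x) (rho_slope a L (a x) (angle_of a x y)).
Proof.
intros HA HD; assert (HP := admissible_profile _ _ _ _ HA).
destruct (angle_of_spec _ _ _ _ _ _ HA HD) as [B E].
assert (Hx : 0 < x) by apply HD.
assert (Hp := a_pos _ _ _ _ x HA Hx).
assert (Da := is_derive_a _ _ _ _ x HA Hx).
set (th := angle_of a x y) in *.
replace (signed_shift_tau a L (a x) th * adot a x) with
  (adot a x * signed_shift_A a L (a x) th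
   - rho_slope a L (a x) th * (adot a x * (dist_int (hublS a L) (a x) th / a x)))
  by (unfold signed_shift_tau; ring).
apply (differentiable_along_level (fun u t => signed_shift a L (a u) t) (fermi_dist a L) (angle_of a));
  fold th.
- apply locally_2d_impl with (2 := domD_open _ _ _ _ _ _ HA HD).
  apply locally_2d_forall; intros u v Hu; apply (angle_of_spec _ _ _ _ _ _ HA Hu).
- intros eps He.
  destruct (shift_increment _ _ _ (a x) th eps HP Hp B He) as [d [Hd H]].
  destruct (is_derive_continuity_pt _ _ _ Da d Hd) as [d2 [Hd2 H2]].
  exists (Rmin d d2); split; [apply Rmin_pos; auto|]; intros u t Hu Ht.
  assert (L1 := Rmin_l d d2); assert (L2 := Rmin_r d d2).
  apply H; [|lra].
  destruct (Req_dec u x) as [->|N]; [rewrite Rminus_diag, Rabs_R0; auto|].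
  apply (H2 u); split; [split; [exact I|auto]|]; simpl; unfold Rdist; lra.
- apply (is_derive_comp (fun A => dist_int (hubS a L) A th) a); auto.
  apply (is_derive_dist_int_A _ _ _ _ _ HP); auto.
- apply (is_derive_comp (fun A => signed_shift a L A th) a); auto.
  apply is_derive_odd_reflection_A with (PI / 2) ; auto.
  intros t Ht; apply (is_derive_half_shift_A _ _ _ _ _ HP); auto.
- apply (angle_of_continuous _ _ _ _ _ _ HA HD).
Qed.

Lemma continuity_2d_pt_along (a : R -> R) (K C L x y : R) (q : R -> R -> R) :
  admissible a K C L -> domD a x y ->
  continuity_2d_pt q (a x) (angle_of a x y) ->
  continuity_2d_pt (fun u v => q (a u) (angle_of a u v)) x y.
Proof.
intros HA HD Hq.
apply (continuity_2d_pt_comp2 q (fun u _ => a u) (angle_of a)); auto.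
- eapply continuity_2d_pt_a_fst; eauto; apply HD.
- apply (angle_of_continuous _ _ _ _ _ _ HA HD).
Qed.

Lemma continuity_2d_pt_rho_slope (a : R -> R) (K C L A th : R) :
  admissible a K C L -> 0 < A -> Rabs th < PI / 2 -> continuity_2d_pt (rho_slope a L) A th.
Proof.
intros HA; apply (continuity_2d_pt_shift_slope _ _ _ _ _ (admissible_profile _ _ _ _ HA)).
Qed.

Lemma continuity_2d_pt_signed_shift_tau (a : R -> R) (K C L A th : R) :
  admissible a K C L -> 0 < A -> Rabs th < PI / 2 -> continuity_2d_pt (signed_shift_tau a L) A th.
Proof.
intros HA HA0 Hth; assert (HP := admissible_profile _ _ _ _ HA).
apply (continuity_2d_pt_minus (signed_shift_A a L)
  (fun A th => rho_slope a L A th * (dist_int (hublS a L) A th / A))).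
- apply continuity_2d_pt_odd_reflection with (PI / 2); auto.
  intros t Ht; apply (continuity_2d_pt_half_shift_A _ _ _ _ _ HP); auto.
- apply (continuity_2d_pt_mult (rho_slope a L) (fun A th => dist_int (hublS a L) A th / A)).
  + apply (continuity_2d_pt_rho_slope _ _ _ _ _ _ HA); auto.
  + apply (continuity_2d_pt_mult (dist_int (hublS a L)) (fun A _ => / A)).
    * apply continuity_2d_pt_dist_int, (hp_cont_l _ _ _ HP).
    * apply continuity_2d_pt_inv_fst; lra.
Qed.

Lemma differentiable_neg_sq (X Y : R) :
  differentiable_pt_lim (fun X Y => - (1 - X * Y) ^ 2) X Y
    (2 * (1 - X * Y) * Y) (2 * (1 - X * Y) * X).
Proof.
apply filterdiff_differentiable_pt_lim.
apply (is_derive_filterdiff (fun X Y => - (1 - X * Y) ^ 2) X Y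
  (fun X Y => 2 * (1 - X * Y) * Y) (2 * (1 - X * Y) * X)).
- apply filter_forall; intros u; auto_derive; auto; ring.
- auto_derive; auto; ring.
- apply (continuity_2d_pt_filterlim (fun X Y => 2 * (1 - X * Y) * Y)).
  apply (continuity_2d_pt_mult (fun X Y => 2 * (1 - X * Y)) (fun _ Y => Y));
    [|apply continuity_2d_pt_id2].
  apply (continuity_2d_pt_mult (fun _ _ => 2)); [apply continuity_2d_pt_const|].
  apply (continuity_2d_pt_minus (fun _ _ => 1)); [apply continuity_2d_pt_const|].
  apply continuity_2d_pt_mult; [apply continuity_2d_pt_id1|apply continuity_2d_pt_id2].
Qed.

Theorem theorem5p14 (a : R -> R) (K C : R) :
  strongly_regular_scale_factor a K ->
  ( (filterlim (adot a) (at_right 0) (locally 0) /\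
     exists eps, 0 < eps /\ forall t, 0 < t < eps -> 0 <= addot a t)
    \/
    (exists L, 0 < L /\ filterlim (adot a) (at_right 0) (locally L)) ) ->
  0 < C ->
  (forall t, 0 < t ->
     ex_derive (addot a) t /\
     Rabs (adddot a t * a t ^ 2 / (adot a t) ^ 3) <= C) ->
  C1_on (domD a) (g_tautau a).
Proof.
intros HR Hcase _ H3; destruct (admissible_of_hyps a K C HR Hcase H3) as [L HA].
set (W u v := 2 * (1 - adot a u * shift_on_D a L u v)).
set (Fx u v := signed_shift_tau a L (a u) (angle_of a u v) * adot a u).
set (Fy u v := rho_slope a L (a u) (angle_of a u v)).
(* Chain rule for [- (1 - X * Y) ^ 2] with [X = adot a u] and [Y] the shift: the partials are
   [W * Y] and [W * X]. The factor 0 is the rho-derivative of [adot a u]. *)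
exists (fun u v => W u v * shift_on_D a L u v * addot a u + W u v * adot a u * Fx u v),
  (fun u v => W u v * shift_on_D a L u v * 0 + W u v * adot a u * Fy u v).
intros x y HD; destruct (angle_of_spec _ _ _ _ _ _ HA HD) as [B E].
assert (Hx : 0 < x) by apply HD.
assert (Hp := a_pos _ _ _ _ x HA Hx).
assert (DF := differentiable_shift_on_D _ _ _ _ _ _ HA HD).
assert (Dd := is_derive_adot _ _ _ _ x HA Hx).
assert (CF : continuity_2d_pt (shift_on_D a L) x y).
{ apply differentiable_continuity_pt; eexists; eexists; exact DF. }
assert (Cd : continuity_2d_pt (fun u _ => adot a u) x y).
{ apply continuity_2d_pt_fst; eapply is_derive_continuity_pt; eauto. }
assert (CW : continuity_2d_pt W x y).
{ apply (continuity_2d_pt_mult (fun _ _ => 2)); [apply continuity_2d_pt_const|].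
  apply (continuity_2d_pt_minus (fun _ _ => 1)); [apply continuity_2d_pt_const|].
  apply (continuity_2d_pt_mult (fun u _ => adot a u)); auto. }
assert (CWF : continuity_2d_pt (fun u v => W u v * shift_on_D a L u v) x y)
  by (apply continuity_2d_pt_mult; auto).
assert (CWd : continuity_2d_pt (fun u v => W u v * adot a u) x y)
  by (apply (continuity_2d_pt_mult W (fun u _ => adot a u)); auto).
split; [|split].
- apply differentiable_pt_lim_ext with (fun u v => - (1 - adot a u * shift_on_D a L u v) ^ 2).
  (* The closed form agrees with [g_tautau] on the domain, which is open, so it may replace it in a
     derivative. *)
  + apply locally_2d_impl with (2 := domD_open _ _ _ _ _ _ HA HD).
    apply locally_2d_forall; intros u v Hu; unfold g_tautau.
    now rewrite (f_fun_shift_on_D _ _ _ _ _ _ HA Hu).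
  + apply (differentiable_pt_lim_comp (fun X Y => - (1 - X * Y) ^ 2)
      (fun u _ => adot a u) (shift_on_D a L)); auto.
    * apply differentiable_neg_sq.
    * apply differentiable_pt_lim_proj1_0, is_derive_Reals; auto.
- apply (continuity_2d_pt_plus (fun u v => W u v * shift_on_D a L u v * addot a u)
    (fun u v => W u v * adot a u * Fx u v)).
  + apply (continuity_2d_pt_mult (fun u v => W u v * shift_on_D a L u v) (fun u _ => addot a u)); auto.
    apply continuity_2d_pt_fst; eapply is_derive_continuity_pt, is_derive_addot; eauto.
  + apply (continuity_2d_pt_mult (fun u v => W u v * adot a u) Fx); auto.
    apply (continuity_2d_pt_mult (fun u v => signed_shift_tau a L (a u) (angle_of a u v))
      (fun u _ => adot a u)); auto.
    apply (continuity_2d_pt_along _ _ _ _ _ _ _ HA HD).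
    apply (continuity_2d_pt_signed_shift_tau _ _ _ _ _ _ HA); auto.
- apply (continuity_2d_pt_plus (fun u v => W u v * shift_on_D a L u v * 0)
    (fun u v => W u v * adot a u * Fy u v)).
  + apply (continuity_2d_pt_mult (fun u v => W u v * shift_on_D a L u v) (fun _ _ => 0)); auto.
    apply continuity_2d_pt_const.
  + apply (continuity_2d_pt_mult (fun u v => W u v * adot a u) Fy); auto.
    apply (continuity_2d_pt_along _ _ _ _ _ _ _ HA HD).
    apply (continuity_2d_pt_rho_slope _ _ _ _ _ _ HA); auto.
Qed.
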